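(* Let $X$ be a connected, countable, simple graph with bounded degree, let $t,u\in\mathbb{C}$ with $|t|<1$ and $|u|<1/\alpha(t)$, and let $x_0,x\in VX$. Then \[ \begin{aligned} Z_X(u,t,x_0,x)&=\big(1-(1-t)^2u^2\big)^{-\frac{\deg(x_0)-2}{2}\delta_{x_0}(x)}\exp\Big(-\big[\log\big(I-u(D_X-\Delta_X)+(1-t)Q_X(t)u^2\big)\big](x_0,x)\Big)\\ &\quad\times\exp\Big(\int_0^u(1-t)z^2\sum_{n=2}^{\infty}\frac1n\sum_{j=1}^{n-1}j\,\big[f(z)^{n-1-j}(A_XD_X-D_XA_X)f(z)^{j-1}\big](x_0,x)\,dz\Big)\\ &\quad\times\exp\Big(\frac{[tD_X-C_2(t)](x_0,x)}{2}(1-t)u^2\Big)\exp\Big(\sum_{m=3}^{\infty}\frac{(1-t)R_m(t)(x_0,x)}{m}u^m\Big). \end{aligned} \]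
   Context: Graphs: $X$ has vertex set $VX$ and oriented edges $EX$, each $e$ with origin $o(e)$, terminus $\mathrm{ter}(e)$ and inverse $\bar e$ ($\bar e\ne e$, $\bar{\bar e}=e$, $o(\bar e)=\mathrm{ter}(e)$); simple = no loops or multiple edges; $E_x=\{e:o(e)=x\}$, $\deg(x)=|E_x|$, $M=\max_x\deg(x)<\infty$. A path of length $n$ is $C=(e_1,\dots,e_n)$ with $\mathrm{ter}(e_i)=o(e_{i+1})$; a vertex is a path of length $0$. $\mathrm{bc}(C)=\#\{i\in\{1,\dots,n-1\}:e_{i+1}=\bar e_i\}$. Operators on $\ell^2(VX)$: $(A_Xf)(x)=\sum_{e\in E_x}f(\mathrm{ter}(e))$, $(D_Xf)(x)=\deg(x)f(x)$, $\Delta_X=D_X-A_X$, $Q_X(t)=D_X-(1-t)I$, $f(z)=zA_X-z^2(1-t)Q_X(t)$. For bounded $B$, $B(x_1,x_2):=(B\delta_{x_1})(x_2)$. $(C_m(t)f)(x)=\sum_C t^{\mathrm{bc}(C)}f(\mathrm{ter}(C))$ over paths $C$ of length $m$ starting at $x$ ($C_0(t)=I$). For $k\ge0$, $(\Delta_Xc_k)(x):=\deg(x)C_k(t)(x,x)-\sum_{e\in E_x}C_k(t)(\mathrm{ter}(e),\mathrm{ter}(e))$; for $m\ge1$, $R_m(t)(x)=\sum_{j=1}^{\lceil m/2\rceil-1}\sum_{i=1}^{j}(1-t)^{2(j-i)}(1-t^2)^{i-1}(\Delta_Xc_{m-2j})(x)$, and $R_m(t)$ also denotes the multiplication operator $f\mapsto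 R_m(t)(\cdot)f(\cdot)$ (so $R_m(t)(x_0,x)=\delta_{x_0}(x)R_m(t)(x_0)$). Define operators $C^{\mathrm{cbc}}_m(t)$: $C^{\mathrm{cbc}}_m(t)=C_m(t)$ for $m=0,1$; $C^{\mathrm{cbc}}_2(t)=tC_2(t)$; for $m\ge3$, \[ C^{\mathrm{cbc}}_m(t)=C_m(t)-(D_X-2(1-t)I)\sum_{j=1}^{\lceil m/2\rceil-1}(1-t)^{2j-1}C_{m-2j}(t)+(1-t)R_m(t)-\delta_{2\mathbb{Z}}(m)(1-t)^{m-1}tD_X, \] with $\delta_{2\mathbb{Z}}(m)=1$ for even $m$, $0$ otherwise. Then $Z_X(u,t,x_0,x)=\exp\big(\sum_{m\ge1}\frac{C^{\mathrm{cbc}}_m(t)(x_0,x)}{m}u^m\big)$. Also $\alpha(t)=\frac{M+\sqrt{M^2+4(|t|+1)M}}{2}$, $\delta_{x_0}(x)$ is the Kronecker delta, $\log(I-B)=-\sum_{n\ge1}B^n/n$ for $\|B\|<1$, the integral is along the segment from $0$ to $u$, and the first power is taken with the principal branch of the logarithm. *)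

(* Defs.v *)
From Stdlib Require Export Reals List.
From Stdlib Require Import Lra Lia FunctionalExtensionality ProofIrrelevance
  ClassicalEpsilon.
From Coquelicot Require Export Coquelicot.

Set Implicit Arguments.
Unset Strict Implicit.
Unset Printing Implicit Defensive.

Open Scope R_scope.

Definition rsum (A : Type) (l : list A) (f : A -> R) : R :=
  fold_right (fun a r => f a + r) 0 l.

Definition csum (A : Type) (l : list A) (f : A -> C) : C :=
  fold_right (fun a r => (f a + r)%C) (RtoC 0) l.

Section ListSums.
Variable A : Type.
Implicit Types (l : list A) (f g : A -> R).

Lemma rsum_ext l f g : (forall a, In a l -> f a = g a) -> rsum l f = rsum l g.
Proof.
  induction l as [|a l IH]; simpl; intros H; auto.
  rewrite (H a), IH; auto.
Qed.

Lemma rsum_le l f g : (forall a, In a l -> f a <= g a) -> rsum l f <= rsum l g.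
Proof.
  induction l as [|a l IH]; simpl; intros H; [lra|].
  apply Rplus_le_compat; auto.
Qed.

Lemma rsum_ge0 l f : (forall a, 0 <= f a) -> 0 <= rsum l f.
Proof.
  intros H; induction l as [|a l IH]; simpl; [lra|]. specialize (H a); lra.
Qed.

Lemma rsum_app l1 l2 f : rsum (l1 ++ l2) f = rsum l1 f + rsum l2 f.
Proof. induction l1 as [|a l IH]; simpl; [lra|]; rewrite IH; lra. Qed.

Lemma rsum_scal k l f : rsum l (fun a => k * f a) = k * rsum l f.
Proof. induction l as [|a l IH]; simpl; [lra|]; rewrite IH; lra. Qed.

Lemma rsum_plus l f g : rsum l (fun a => f a + g a) = rsum l f + rsum l g.
Proof. induction l as [|a l IH]; simpl; [lra|]; rewrite IH; lra. Qed.

Lemma rsum_const k l : rsum l (fun _ => k) = INR (length l) * k.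
Proof.
  induction l as [|a l IH]; [simpl; lra|].
  change (k + rsum l (fun _ => k) = INR (S (length l)) * k).
  rewrite IH, S_INR; lra.
Qed.

End ListSums.

Section ListSums2.
Variable A : Type.
Implicit Types (l : list A) (f g : A -> R).

Lemma rsum_flat_map (B : Type) (h : A -> list B) l (f : B -> R) :
  rsum (flat_map h l) f = rsum l (fun a => rsum (h a) f).
Proof.
  induction l as [|a l IH]; simpl; auto. rewrite rsum_app, IH; auto.
Qed.

Lemma rsum_map (B : Type) (h : A -> B) l (f : B -> R) :
  rsum (map h l) f = rsum l (fun a => f (h a)).
Proof. induction l as [|a l IH]; simpl; auto. rewrite IH; auto. Qed.

Lemma rsum_incl l l' f :
  (forall a, 0 <= f a) -> NoDup l -> incl l l' -> rsum l f <= rsum l' f.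
Proof.
  intros Hf; revert l'; induction l as [|a l IH]; intros l' Hn Hi; simpl.
  - apply rsum_ge0; auto.
  - inversion Hn as [|? ? Ha Hl]; subst.
    destruct (in_split a l') as (l1 & l2 & ->); [apply Hi; left; auto|].
    rewrite rsum_app; simpl.
    assert (H : rsum l f <= rsum (l1 ++ l2) f).
    { apply IH; auto. intros b Hb.
      assert (Hb' := Hi b (or_intror Hb)).
      apply in_app_or in Hb'; apply in_or_app.
      destruct Hb' as [|[->|]]; tauto. }
    rewrite rsum_app in H; lra.
Qed.

Lemma rsum_cauchy_schwarz l f g :
  (rsum l (fun a => f a * g a)) ^ 2
    <= rsum l (fun a => f a ^ 2) * rsum l (fun a => g a ^ 2).
Proof.
  induction l as [|a l IH]; [simpl; lra|].
  change ((f a * g a + rsum l (fun a => f a * g a)) ^ 2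
    <= (f a ^ 2 + rsum l (fun a => f a ^ 2))
       * (g a ^ 2 + rsum l (fun a => g a ^ 2))).
  set (x := rsum l (fun a => f a * g a)) in *.
  assert (HP : 0 <= rsum l (fun a => f a ^ 2)) by (apply rsum_ge0; intros; nra).
  assert (HQ : 0 <= rsum l (fun a => g a ^ 2)) by (apply rsum_ge0; intros; nra).
  set (P := rsum l (fun a => f a ^ 2)) in *.
  set (Q := rsum l (fun a => g a ^ 2)) in *.
  set (a1 := f a); set (b1 := g a).
  enough (2 * (x * (a1 * b1)) <= P * b1 ^ 2 + Q * a1 ^ 2) by nra.
  assert (H0 : 0 <= P * b1 ^ 2 + Q * a1 ^ 2)
    by (apply Rplus_le_le_0_compat; apply Rmult_le_pos; auto; nra).
  apply Rsqr_incr_0_var; auto. unfold Rsqr.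
  assert (H1 : x ^ 2 * (a1 * b1) ^ 2 <= P * Q * (a1 * b1) ^ 2)
    by (apply Rmult_le_compat_r; auto; nra).
  assert (H2 : 0 <= (P * b1 ^ 2 - Q * a1 ^ 2) ^ 2) by apply pow2_ge_0.
  replace (2 * (x * (a1 * b1)) * (2 * (x * (a1 * b1))))
    with (4 * (x ^ 2 * (a1 * b1) ^ 2)) by ring.
  replace ((P * b1 ^ 2 + Q * a1 ^ 2) * (P * b1 ^ 2 + Q * a1 ^ 2))
    with ((P * b1 ^ 2 - Q * a1 ^ 2) ^ 2 + 4 * (P * Q * (a1 * b1) ^ 2)) by ring.
  lra.
Qed.

Lemma rsum_minkowski l f g P Q :
  0 <= P -> 0 <= Q ->
  rsum l (fun a => f a ^ 2) <= P ^ 2 -> rsum l (fun a => g a ^ 2) <= Q ^ 2 ->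
  rsum l (fun a => (f a + g a) ^ 2) <= (P + Q) ^ 2.
Proof.
  intros HP HQ Hf Hg.
  assert (E : rsum l (fun a => (f a + g a) ^ 2) =
    rsum l (fun a => f a ^ 2) + 2 * rsum l (fun a => f a * g a)
      + rsum l (fun a => g a ^ 2)).
  { rewrite <- rsum_scal, <- !rsum_plus. apply rsum_ext; intros; ring. }
  enough (rsum l (fun a => f a * g a) <= P * Q) by (rewrite E; nra).
  apply Rsqr_incr_0_var; [|apply Rmult_le_pos; auto].
  pose proof (rsum_cauchy_schwarz l f g) as H.
  assert (H0 : 0 <= rsum l (fun a => f a ^ 2)) by (apply rsum_ge0; intros; nra).
  assert (H1 : 0 <= rsum l (fun a => g a ^ 2)) by (apply rsum_ge0; intros; nra).
  pose proof (Rmult_le_compat _ _ _ _ H0 H1 Hf Hg). unfold Rsqr; nra.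
Qed.

Lemma csum_Cmod l (f : A -> C) : Cmod (csum l f) <= rsum l (fun a => Cmod (f a)).
Proof.
  induction l as [|a l IH]; simpl; [rewrite Cmod_0; lra|].
  eapply Rle_trans; [apply Cmod_triangle|]. lra.
Qed.

Lemma csum_plus l (f g : A -> C) :
  csum l (fun a => (f a + g a)%C) = (csum l f + csum l g)%C.
Proof. induction l as [|a l IH]; simpl; [ring|]; rewrite IH; ring. Qed.

Lemma csum_scal l k (f : A -> C) :
  csum l (fun a => (k * f a)%C) = (k * csum l f)%C.
Proof. induction l as [|a l IH]; simpl; [ring|]; rewrite IH; ring. Qed.

Lemma csum_ext l (f g : A -> C) : (forall a, f a = g a) -> csum l f = csum l g.
Proof. intros H; induction l as [|a l IH]; simpl; auto. rewrite H, IH; auto. Qed.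

End ListSums2.

Definition series_sum (K : AbsRing) (V : NormedModule K) (a : nat -> V) : V :=
  epsilon (inhabits zero) (fun l : V => is_series a l).

Definition Cexp (z : C) : C :=
  (RtoC (exp (Re z)) * (cos (Im z), sin (Im z)))%C.

(** The argument in ]-PI, PI]; irrelevant at 0. *)
Definition Carg (z : C) : R :=
  if Rle_dec 0 (Im z) then acos (Re z / Cmod z) else - acos (Re z / Cmod z).

Definition Clog (z : C) : C := (ln (Cmod z), Carg z).

Definition Cpower (z a : C) : C := Cexp (a * Clog z)%C.

(** [segment_param g u] is the pullback of [g(z) dz] by [s |-> s u], [0 <= s <= 1]. *)
Definition segment_param (g : C -> C) (u : C) (s : R) : C :=
  (g (RtoC s * u) * u)%C.

Definition segment_int (g : C -> C) (u : C) : C :=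
  RInt (V := C_R_CompleteNormedModule) (segment_param g u) 0 1.

Definition ex_segment_int (g : C -> C) (u : C) : Prop :=
  ex_RInt (V := C_R_NormedModule) (segment_param g u) 0 1.

Section L2.
Variable V : Type.
Implicit Types f g : V -> C.

Definition sqsum f (s : list V) : R := rsum s (fun x => Cmod (f x) ^ 2).

Definition square_summable f : Prop :=
  exists B, forall s, NoDup s -> sqsum f s <= B.

Record l2 : Type := L2 { l2_fun :> V -> C; l2_prop : square_summable l2_fun }.

Definition l2_norm (f : l2) : R :=
  sqrt (real (Lub_Rbar (fun r => exists s, NoDup s /\ r = sqsum f s))).

Lemma sqsum_ge0 f s : 0 <= sqsum f s.
Proof. apply rsum_ge0; intros; apply pow2_ge_0. Qed.

Lemma l2_eq (f g : l2) : (forall x, f x = g x) -> f = g.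
Proof.
  destruct f as [f Hf], g as [g Hg]; simpl; intros H.
  assert (E : f = g) by (apply functional_extensionality; auto).
  subst g; f_equal; apply proof_irrelevance.
Qed.

Lemma l2_norm_ge0 (f : l2) : 0 <= l2_norm f.
Proof. apply sqrt_pos. Qed.

Lemma l2_norm_lub (f : l2) :
  (forall s, NoDup s -> sqsum f s <= l2_norm f ^ 2) /\
  (forall K, 0 <= K -> (forall s, NoDup s -> sqsum f s <= K ^ 2) ->
     l2_norm f <= K).
Proof.
  unfold l2_norm.
  set (E := fun r => exists s, NoDup s /\ r = sqsum f s).
  destruct (Lub_Rbar_correct E) as [Hub Hlub].
  assert (H0 : E 0) by (exists nil; split; [constructor|reflexivity]).
  destruct (l2_prop f) as [B HB].
  assert (HuB : Rbar_le (Lub_Rbar E) B).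
  { apply Hlub. intros r (s & Hs & ->). simpl; auto. }
  assert (H0' := Hub 0 H0).
  destruct (Lub_Rbar E) as [m| |]; simpl in HuB, H0'; try contradiction.
  unfold real; split.
  - intros s Hs. rewrite <- Rsqr_pow2, Rsqr_sqrt; auto.
    apply (Hub (sqsum f s)). exists s; auto.
  - intros K HK H.
    rewrite <- (sqrt_pow2 K) by auto. apply sqrt_le_1_alt.
    apply (Hlub (Finite (K ^ 2))). intros r (s & Hs & ->); simpl; auto.
Qed.

Lemma sqsum_le_norm (f : l2) s : NoDup s -> sqsum f s <= l2_norm f ^ 2.
Proof. apply (proj1 (l2_norm_lub f)). Qed.

Lemma l2_norm_le (f : l2) K :
  0 <= K -> (forall s, NoDup s -> sqsum f s <= K ^ 2) -> l2_norm f <= K.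
Proof. apply (proj2 (l2_norm_lub f)). Qed.

Lemma Cmod_le_l2_norm (f : l2) x : Cmod (f x) <= l2_norm f.
Proof.
  apply Rsqr_incr_0_var; [|apply l2_norm_ge0]. rewrite !Rsqr_pow2.
  assert (H := @sqsum_le_norm f (x :: nil)). unfold sqsum, rsum in H; simpl in H.
  simpl. enough (NoDup (x :: nil)) by (specialize (H H0); lra).
  constructor; auto; constructor.
Qed.

Lemma sqsum_plus f g P Q s : 0 <= P -> 0 <= Q ->
  sqsum f s <= P ^ 2 -> sqsum g s <= Q ^ 2 ->
  sqsum (fun x => (f x + g x)%C) s <= (P + Q) ^ 2.
Proof.
  intros HP HQ Hf Hg.
  eapply Rle_trans; [|apply (rsum_minkowski HP HQ Hf Hg)].
  apply rsum_le; intros x _. apply pow_incr. split; [apply Cmod_ge_0|].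
  apply Cmod_triangle.
Qed.

Lemma sqsum_scal k f s : sqsum (fun x => (k * f x)%C) s = Cmod k ^ 2 * sqsum f s.
Proof.
  unfold sqsum. rewrite <- rsum_scal. apply rsum_ext; intros.
  rewrite Cmod_mult; ring.
Qed.

Lemma square_summable_plus (f g : l2) : square_summable (fun x => (f x + g x)%C).
Proof.
  exists ((l2_norm f + l2_norm g) ^ 2). intros s Hs.
  apply sqsum_plus; auto using l2_norm_ge0, sqsum_le_norm.
Qed.

Lemma square_summable_scal k (f : l2) : square_summable (fun x => (k * f x)%C).
Proof.
  exists (Cmod k ^ 2 * l2_norm f ^ 2). intros s Hs. rewrite sqsum_scal.
  apply Rmult_le_compat_l; [apply pow2_ge_0|]. apply sqsum_le_norm; auto.
Qed.

Lemma square_summable_zero : square_summable (fun _ : V => RtoC 0).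
Proof.
  exists 0. intros s _. unfold sqsum. rewrite rsum_const, Cmod_0. simpl; lra.
Qed.

Lemma square_summable_opp (f : l2) : square_summable (fun x => (- f x)%C).
Proof.
  exists (l2_norm f ^ 2). intros s Hs. unfold sqsum.
  rewrite (rsum_ext (g := fun x => Cmod (f x) ^ 2));
    [apply sqsum_le_norm; auto|]. intros; rewrite Cmod_opp; auto.
Qed.

Definition l2_plus (f g : l2) : l2 := L2 (square_summable_plus f g).
Definition l2_zero : l2 := L2 square_summable_zero.
Definition l2_opp (f : l2) : l2 := L2 (square_summable_opp f).
Definition l2_scal (k : C) (f : l2) : l2 := L2 (square_summable_scal k f).

Definition l2_AbelianMonoid_mixin : AbelianMonoid.mixin_of l2.
Proof.
  apply (AbelianMonoid.Mixin l2 l2_plus l2_zero);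
    intros; apply l2_eq; intros; simpl; ring.
Defined.
Canonical l2_AbelianMonoid := AbelianMonoid.Pack l2 l2_AbelianMonoid_mixin l2.

Definition l2_AbelianGroup_mixin : AbelianGroup.mixin_of l2_AbelianMonoid.
Proof.
  apply (AbelianGroup.Mixin l2_AbelianMonoid l2_opp);
    intros; apply l2_eq; intros; simpl; ring.
Defined.
Canonical l2_AbelianGroup :=
  AbelianGroup.Pack l2 (AbelianGroup.Class _ _ l2_AbelianGroup_mixin) l2.

Definition l2_ModuleSpace_mixin : ModuleSpace.mixin_of C_Ring l2_AbelianGroup.
Proof.
  apply (ModuleSpace.Mixin C_Ring l2_AbelianGroup l2_scal);
    intros; apply l2_eq; intros; simpl;
    try change (@one C_Ring) with (RtoC 1);
    try change (@mult C_Ring) with Cmult;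
    try change (@plus C_Ring) with Cplus; ring.
Defined.
Canonical l2_ModuleSpace :=
  ModuleSpace.Pack C_Ring l2 (ModuleSpace.Class _ _ _ l2_ModuleSpace_mixin) l2.

Lemma l2_norm_triangle (f g : l2) : l2_norm (l2_plus f g) <= l2_norm f + l2_norm g.
Proof.
  apply l2_norm_le; [generalize (l2_norm_ge0 f) (l2_norm_ge0 g); lra|].
  intros s Hs. apply sqsum_plus; auto using l2_norm_ge0, sqsum_le_norm.
Qed.

Lemma l2_norm_scal k (f : l2) : l2_norm (l2_scal k f) <= Cmod k * l2_norm f.
Proof.
  apply l2_norm_le; [apply Rmult_le_pos; auto using Cmod_ge_0, l2_norm_ge0|].
  intros s Hs. simpl l2_fun. rewrite sqsum_scal, Rpow_mult_distr.
  apply Rmult_le_compat_l; [apply pow2_ge_0|]. apply sqsum_le_norm; auto.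
Qed.

Lemma l2_norm_eq0 (f : l2) : l2_norm f = 0 -> f = l2_zero.
Proof.
  intros H. apply l2_eq; intros x; simpl. apply Cmod_eq_0.
  apply Rle_antisym; [|apply Cmod_ge_0]. rewrite <- H. apply Cmod_le_l2_norm.
Qed.

Lemma l2_norm_zero : l2_norm l2_zero = 0.
Proof.
  apply Rle_antisym; [|apply l2_norm_ge0].
  apply l2_norm_le; [lra|]. intros s _. unfold sqsum; simpl l2_fun.
  rewrite rsum_const, Cmod_0. simpl; lra.
Qed.

End L2.

Section NormBall.
Variable E : ModuleSpace C_Ring.
Variable nrm : E -> R.
Hypothesis nrm0 : nrm zero = 0.
Hypothesis nrmD : forall x y, nrm (plus x y) <= nrm x + nrm y.
Hypothesis nrmZ : forall (k : C) x, nrm (scal k x) <= Cmod k * nrm x.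
Hypothesis nrmE : forall x, nrm x = 0 -> x = zero.

Definition norm_UniformSpace_mixin : UniformSpace.mixin_of E.
Proof.
  apply (UniformSpace.Mixin E zero (fun x e y => nrm (minus y x) < e)).
  - intros x e. eapply Rle_lt_trans; [right|apply (cond_pos e)].
    etransitivity; [|exact nrm0]. apply f_equal.
    exact (@minus_eq_zero (ModuleSpace.AbelianGroup C_Ring E) x).
  - intros x y e H. rewrite <- opp_minus.
    rewrite <- (scal_opp_one (minus y x)).
    eapply Rle_lt_trans; [apply nrmZ|].
    change (@opp (Ring.AbelianGroup C_Ring) (@one C_Ring)) with (- RtoC 1)%C.
    rewrite Cmod_opp, Cmod_1; lra.
  - intros x y z e1 e2 H1 H2. rewrite (minus_trans y).
    eapply Rle_lt_trans; [apply nrmD|]. lra.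
Defined.

Definition norm_NormedModuleAux : NormedModuleAux C_AbsRing :=
  NormedModuleAux.Pack C_AbsRing E
    (NormedModuleAux.Class C_AbsRing E (ModuleSpace.class C_Ring E)
       norm_UniformSpace_mixin) E.

Definition norm_NormedModule_mixin :
  NormedModule.mixin_of C_AbsRing norm_NormedModuleAux.
Proof.
  apply (NormedModule.Mixin C_AbsRing norm_NormedModuleAux nrm 1).
  - exact nrmD.
  - exact nrmZ.
  - intros x y eps H; exact H.
  - intros x y eps H; rewrite Rmult_1_l; exact H.
  - exact nrmE.
Defined.

End NormBall.

Section L2Normed.
Variable V : Type.

Definition l2_UniformSpace_mixin : UniformSpace.mixin_of (l2 V) :=
  @norm_UniformSpace_mixin (l2_ModuleSpace V) (@l2_norm V) (l2_norm_zero V)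
    (@l2_norm_triangle V) (@l2_norm_scal V).
Canonical l2_UniformSpace :=
  UniformSpace.Pack (l2 V) l2_UniformSpace_mixin (l2 V).

Canonical l2_NormedModuleAux :=
  NormedModuleAux.Pack C_AbsRing (l2 V)
    (NormedModuleAux.Class C_AbsRing (l2 V)
       (ModuleSpace.class C_Ring (l2_ModuleSpace V)) l2_UniformSpace_mixin) (l2 V).

Definition l2_NormedModule_mixin :
  NormedModule.mixin_of C_AbsRing l2_NormedModuleAux :=
  @norm_NormedModule_mixin (l2_ModuleSpace V) (@l2_norm V) (l2_norm_zero V)
    (@l2_norm_triangle V) (@l2_norm_scal V) (@l2_norm_eq0 V).
Canonical l2_NormedModule :=
  NormedModule.Pack C_AbsRing (l2 V)
    (NormedModule.Class C_AbsRing (l2 V)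
       (NormedModuleAux.class C_AbsRing l2_NormedModuleAux)
       l2_NormedModule_mixin) (l2 V).

End L2Normed.

Section BoundedOperators.
Variable U : NormedModule C_AbsRing.

Record bop : Type := Bop { bop_fun :> U -> U; bop_linear : is_linear bop_fun }.
Implicit Types S T : bop.

Definition bop_norm T : R :=
  real (Lub_Rbar (fun r => exists x : U, norm x <= 1 /\ r = norm (T x))).

Lemma bop_eq S T : (forall x, S x = T x) -> S = T.
Proof.
  destruct S as [f Hf], T as [g Hg]; simpl; intros H.
  assert (E : f = g) by (apply functional_extensionality; auto).
  subst g; f_equal; apply proof_irrelevance.
Qed.

Lemma bop_plus_linear S T : is_linear (fun x => plus (S x) (T x)).
Proof.
  destruct S as [f [f1 f2 (P & HP & f3)]], T as [g [g1 g2 (Q & HQ & g3)]]; simpl.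
  split.
  - intros x y. rewrite f1, g1, <- !plus_assoc. f_equal.
    rewrite !plus_assoc. f_equal. apply plus_comm.
  - intros k x. rewrite f2, g2. symmetry; apply (@scal_distr_l C_Ring U).
  - exists (P + Q); split; [lra|]. intros x.
    eapply Rle_trans; [apply norm_triangle|].
    specialize (f3 x); specialize (g3 x); lra.
Qed.

Lemma bop_zero_linear : is_linear (fun _ : U => zero : U).
Proof. apply is_linear_zero. Qed.

Lemma bop_opp_linear T : is_linear (fun x => opp (T x)).
Proof.
  destruct T as [f [f1 f2 (P & HP & f3)]]; simpl. split.
  - intros x y. rewrite f1. apply (@opp_plus U).
  - intros k x. rewrite f2. symmetry; apply (@scal_opp_r C_Ring U).
  - exists P; split; auto. intros x. rewrite norm_opp; auto.
Qed.

Lemma bop_scal_linear (k : C) T : is_linear (fun x => scal k (T x)).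
Proof.
  destruct T as [f [f1 f2 (P & HP & f3)]]; simpl. split.
  - intros x y. rewrite f1. apply (@scal_distr_l C_Ring U).
  - intros l x. rewrite f2.
    etransitivity; [apply (@scal_assoc C_Ring U)|].
    etransitivity; [|symmetry; apply (@scal_assoc C_Ring U)].
    f_equal. apply Cmult_comm.
  - exists ((Cmod k + 1) * P). pose proof (Cmod_ge_0 k). split.
    + apply Rmult_lt_0_compat; lra.
    + intros x. eapply Rle_trans; [apply (@norm_scal C_AbsRing U)|].
      change (abs k) with (Cmod k). specialize (f3 x).
      pose proof (norm_ge_0 (f x)).
      rewrite Rmult_assoc. apply Rmult_le_compat; lra.
Qed.

Lemma bop_comp_linear S T : is_linear (fun x => S (T x)).
Proof.
  destruct S as [f [f1 f2 (P & HP & f3)]], T as [g [g1 g2 (Q & HQ & g3)]]; simpl.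
  split.
  - intros x y. rewrite g1, f1; auto.
  - intros k x. rewrite g2, f2; auto.
  - exists (P * Q); split; [apply Rmult_lt_0_compat; auto|].
    intros x. eapply Rle_trans; [apply f3|]. rewrite Rmult_assoc.
    apply Rmult_le_compat_l; [lra|auto].
Qed.

Lemma bop_one_linear : is_linear (fun x : U => x).
Proof. apply is_linear_id. Qed.

Definition bop_plus S T : bop := Bop (bop_plus_linear S T).
Definition bop_zero : bop := Bop bop_zero_linear.
Definition bop_opp T : bop := Bop (bop_opp_linear T).
Definition bop_scal (k : C) T : bop := Bop (bop_scal_linear k T).
Definition bop_comp S T : bop := Bop (bop_comp_linear S T).
Definition bop_one : bop := Bop bop_one_linear.

Definition bop_AbelianMonoid_mixin : AbelianMonoid.mixin_of bop.
Proof.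
  apply (AbelianMonoid.Mixin bop bop_plus bop_zero); intros; apply bop_eq;
    intros; simpl; [apply plus_comm|apply plus_assoc|apply plus_zero_r].
Defined.
Canonical bop_AbelianMonoid := AbelianMonoid.Pack bop bop_AbelianMonoid_mixin bop.

Definition bop_AbelianGroup_mixin : AbelianGroup.mixin_of bop_AbelianMonoid.
Proof.
  apply (AbelianGroup.Mixin bop_AbelianMonoid bop_opp); intros; apply bop_eq;
    intros; simpl; apply (@plus_opp_r U).
Defined.
Canonical bop_AbelianGroup :=
  AbelianGroup.Pack bop (AbelianGroup.Class _ _ bop_AbelianGroup_mixin) bop.

Definition bop_Ring_mixin : Ring.mixin_of bop_AbelianGroup.
Proof.
  apply (Ring.Mixin bop_AbelianGroup bop_comp bop_one); intros; apply bop_eq;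
    intros; simpl; auto.
  apply linear_plus, bop_linear.
Defined.
Canonical bop_Ring := Ring.Pack bop (Ring.Class _ _ bop_Ring_mixin) bop.

Definition bop_ModuleSpace_mixin : ModuleSpace.mixin_of C_Ring bop_AbelianGroup.
Proof.
  apply (ModuleSpace.Mixin C_Ring bop_AbelianGroup bop_scal);
    intros; apply bop_eq; intros; simpl.
  - apply (@scal_assoc C_Ring U).
  - apply (@scal_one C_Ring U).
  - apply (@scal_distr_l C_Ring U).
  - apply (@scal_distr_r C_Ring U).
Defined.
Canonical bop_ModuleSpace :=
  ModuleSpace.Pack C_Ring bop (ModuleSpace.Class _ _ _ bop_ModuleSpace_mixin) bop.

Lemma bop_norm_lub T :
  (forall x, norm x <= 1 -> norm (T x) <= bop_norm T) /\
  (forall K, (forall x, norm x <= 1 -> norm (T x) <= K) -> bop_norm T <= K).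
Proof.
  unfold bop_norm.
  set (E := fun r => exists x : U, norm x <= 1 /\ r = norm (T x)).
  destruct (Lub_Rbar_correct E) as [Hub Hlub].
  destruct (linear_norm _ (bop_linear T)) as (P & HP & H3).
  assert (HE : E 0).
  { exists zero. rewrite norm_zero; split; [lra|].
    rewrite (linear_zero _ (bop_linear T)), norm_zero; auto. }
  assert (HuB : Rbar_le (Lub_Rbar E) P).
  { apply Hlub. intros r (x & Hx & ->). simpl.
    eapply Rle_trans; [apply H3|]. pose proof (norm_ge_0 x). nra. }
  assert (H0' := Hub 0 HE).
  destruct (Lub_Rbar E) as [m| |]; simpl in HuB, H0'; try contradiction.
  simpl; split.
  - intros x Hx. apply (Hub (norm (T x))). exists x; auto.
  - intros K HK. apply (Hlub (Finite K)). intros r (x & Hx & ->); simpl; auto.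
Qed.

Lemma bop_norm_ge0 T : 0 <= bop_norm T.
Proof.
  assert (H := proj1 (bop_norm_lub T) zero). rewrite norm_zero in H.
  apply Rle_trans with (norm (T zero)); [apply norm_ge_0|apply H; lra].
Qed.

Lemma bop_norm_le T K :
  (forall x, norm x <= 1 -> norm (T x) <= K) -> bop_norm T <= K.
Proof. apply (proj2 (bop_norm_lub T)). Qed.

Lemma norm_bop_le T x : norm (T x) <= bop_norm T * norm x.
Proof.
  destruct (Req_dec (norm x) 0) as [E|E].
  - apply norm_eq_zero in E; subst x.
    rewrite (linear_zero _ (bop_linear T)), norm_zero; lra.
  - assert (Hx : 0 < norm x) by (pose proof (norm_ge_0 x); lra).
    pose (y := scal (RtoC (/ norm x) : C_AbsRing) x).
    assert (Hy : norm y <= 1).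
    { eapply Rle_trans; [apply (@norm_scal C_AbsRing U)|].
      change (abs (RtoC (/ norm x) : C_AbsRing)) with (Cmod (RtoC (/ norm x))).
      rewrite Cmod_R, Rabs_pos_eq; [|left; apply Rinv_0_lt_compat; auto].
      right; field; auto. }
    assert (Ex : x = scal (RtoC (norm x) : C_AbsRing) y).
    { unfold y. rewrite scal_assoc.
      replace (mult (RtoC (norm x) : C_AbsRing) (RtoC (/ norm x))) with (@one C_Ring).
      - symmetry; apply (@scal_one C_Ring U).
      - change (RtoC 1 = (RtoC (norm x) * RtoC (/ norm x))%C).
        rewrite <- RtoC_mult. f_equal; field; auto. }
    rewrite Ex at 1. rewrite (linear_scal _ (bop_linear T)).
    eapply Rle_trans; [apply (@norm_scal C_AbsRing U)|].
    change (abs (RtoC (norm x) : C_AbsRing)) with (Cmod (RtoC (norm x))).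
    rewrite Cmod_R, Rabs_pos_eq by lra. rewrite Rmult_comm.
    apply Rmult_le_compat_r; [lra|]. apply (proj1 (bop_norm_lub T)); auto.
Qed.

Lemma bop_norm_triangle S T :
  bop_norm (bop_plus S T) <= bop_norm S + bop_norm T.
Proof.
  apply bop_norm_le; intros x Hx; simpl.
  eapply Rle_trans; [apply norm_triangle|].
  apply Rplus_le_compat; apply bop_norm_lub; auto.
Qed.

Lemma bop_norm_scal (k : C) T : bop_norm (bop_scal k T) <= Cmod k * bop_norm T.
Proof.
  apply bop_norm_le; intros x Hx; simpl.
  eapply Rle_trans; [apply (@norm_scal C_AbsRing U)|].
  apply Rmult_le_compat_l; [apply Cmod_ge_0|]. apply bop_norm_lub; auto.
Qed.

Lemma bop_norm_zero : bop_norm bop_zero = 0.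
Proof.
  apply Rle_antisym; [|apply bop_norm_ge0].
  apply bop_norm_le; intros x _; simpl. rewrite norm_zero; lra.
Qed.

Lemma bop_norm_eq0 T : bop_norm T = 0 -> T = bop_zero.
Proof.
  intros H; apply bop_eq; intros x; simpl. apply norm_eq_zero.
  apply Rle_antisym; [|apply norm_ge_0].
  eapply Rle_trans; [apply norm_bop_le|]. rewrite H; lra.
Qed.

Definition bop_UniformSpace_mixin : UniformSpace.mixin_of bop :=
  @norm_UniformSpace_mixin bop_ModuleSpace bop_norm bop_norm_zero
    bop_norm_triangle bop_norm_scal.
Canonical bop_UniformSpace := UniformSpace.Pack bop bop_UniformSpace_mixin bop.

Canonical bop_NormedModuleAux :=
  NormedModuleAux.Pack C_AbsRing bop
    (NormedModuleAux.Class C_AbsRing bop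
       (ModuleSpace.class C_Ring bop_ModuleSpace) bop_UniformSpace_mixin) bop.

Definition bop_NormedModule_mixin :
  NormedModule.mixin_of C_AbsRing bop_NormedModuleAux :=
  @norm_NormedModule_mixin bop_ModuleSpace bop_norm bop_norm_zero
    bop_norm_triangle bop_norm_scal bop_norm_eq0.
Canonical bop_NormedModule :=
  NormedModule.Pack C_AbsRing bop
    (NormedModule.Class C_AbsRing bop
       (NormedModuleAux.class C_AbsRing bop_NormedModuleAux)
       bop_NormedModule_mixin) bop.

End BoundedOperators.

Declare Scope op_scope.
Delimit Scope op_scope with op.
Notation "S + T" := (plus S T) : op_scope.
Notation "S - T" := (minus S T) : op_scope.
Notation "S * T" := (mult S T) : op_scope.
Notation "T ^ n" := (pow_n T n%nat) : op_scope.
Notation "k *: T" := (scal (k%C : C) T) (at level 40, T at next level) : op_scope.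

Section OpLog.
Variable U : NormedModule C_AbsRing.

(** The terms [B^n / n], [n = k + 1], of the series of [- log (1 - B)]. *)
Definition op_log_term (B : bop U) (k : nat) : bop U :=
  ((/ RtoC (INR (k + 1))) *: B ^ (k + 1))%op.

(** [log T] for [T = 1 - B] with [||B|| < 1]; the series is taken in the
    operator norm. *)
Definition op_log (T : bop U) : bop U :=
  opp (series_sum (op_log_term (one - T)%op)).

Definition op_log_defined (T : bop U) : Prop :=
  norm (one - T)%op < 1 /\ ex_series (op_log_term (one - T)%op).

End OpLog.

Record graph : Type := Graph {
  VX : Type;
  EX : Type;
  orig : EX -> VX;
  ter : EX -> VX;
  einv : EX -> EX;
  einv_neq : forall e, einv e <> e;
  einvK : forall e, einv (einv e) = e;
  orig_einv : forall e, orig (einv e) = ter e }.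

(** A graph of bounded degree: [star x] enumerates the finite set of edges with
    origin [x], and [maxdeg] is the maximum of the degrees. *)
Record bounded_graph : Type := BoundedGraph {
  bg_graph :> graph;
  star : VX bg_graph -> list (EX bg_graph);
  star_NoDup : forall x, NoDup (star x);
  In_star : forall x e, In e (star x) <-> orig e = x;
  maxdeg : nat;
  maxdeg_ub : forall x, (length (star x) <= maxdeg)%nat;
  maxdeg_attained : exists x, length (star x) = maxdeg }.

Arguments maxdeg : clear implicits.

Section GraphNotions.
Variable X : graph.

Definition simple_graph : Prop :=
  (forall e : EX X, orig e <> ter e) /\
  (forall e e' : EX X, orig e = orig e' -> ter e = ter e' -> e = e').

(** A path is given by its origin [x] and the list of its edges, so that the
    empty list is the path of length 0 reduced to the vertex [x]. *)
Fixpoint is_path (x : VX X) (c : list (EX X)) : Prop :=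
  match c with
  | nil => True
  | e :: c' => orig e = x /\ is_path (ter e) c'
  end.

Fixpoint path_ter (x : VX X) (c : list (EX X)) : VX X :=
  match c with
  | nil => x
  | e :: c' => path_ter (ter e) c'
  end.

Definition connected_graph : Prop :=
  forall x y : VX X, exists c, is_path x c /\ path_ter x c = y.

Definition countable_graph : Prop :=
  exists num : VX X -> nat, forall x y, num x = num y -> x = y.

Fixpoint bc (c : list (EX X)) : nat :=
  match c with
  | e1 :: ((e2 :: _) as c') =>
      (if excluded_middle_informative (e2 = einv e1) then 1 else 0) + bc c'
  | _ => 0
  end.

Lemma ter_einv (e : EX X) : ter (einv e) = orig e.
Proof. rewrite <- orig_einv, einvK; auto. Qed.

End GraphNotions.

Section BoundedGraphOperators.
Variable X : bounded_graph.

Notation V := (VX X).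
Notation Op := (bop (l2_NormedModule V)).

Definition deg (x : V) : nat := length (star x).

Fixpoint paths (m : nat) (x : V) : list (list (EX X)) :=
  match m with
  | O => nil :: nil
  | S m' => flat_map (fun e => map (cons e) (paths m' (ter e))) (star x)
  end.

Lemma paths_spec m x c : In c (paths m x) <-> is_path x c /\ length c = m.
Proof.
  revert x c; induction m as [|m IH]; intros x c; simpl.
  - split.
    + intros [<-|[]]; simpl; auto.
    + intros [_ H]. destruct c; [auto|discriminate].
  - rewrite in_flat_map. split.
    + intros (e & He & Hc). apply in_map_iff in Hc. destruct Hc as (c' & <- & Hc').
      apply IH in Hc'. apply In_star in He. simpl. intuition.
    + destruct c as [|e c']; simpl; [intros [_ H]; discriminate|].
      intros [[H1 H2] H3]. exists e. split; [apply In_star; auto|].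
      apply in_map, IH; auto.
Qed.

Lemma paths_NoDup m x : NoDup (paths m x).
Proof.
  revert x; induction m as [|m IH]; intros x; simpl.
  - constructor; [intros []|constructor].
  - generalize (star_NoDup x). generalize (star x).
    induction l as [|e l IHl]; simpl; intros Hn; [constructor|].
    inversion Hn as [|? ? He Hl]; subst.
    apply NoDup_app; auto.
    + apply NoDup_map_NoDup_ForallPairs; auto. intros c c' _ _ E; inversion E; auto.
    + intros c Hc Hc'. apply in_map_iff in Hc. destruct Hc as (c1 & <- & _).
      apply in_flat_map in Hc'. destruct Hc' as (e' & He' & Hc').
      apply in_map_iff in Hc'. destruct Hc' as (c2 & E & _).
      inversion E; subst; contradiction.
Qed.

Definition sq_bounded (F : (V -> C) -> V -> C) : Prop :=
  exists K, 0 < K /\ forall (f : V -> C) B, 0 <= B ->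
    (forall s, NoDup s -> sqsum f s <= B ^ 2) ->
    forall s, NoDup s -> sqsum (F f) s <= (K * B) ^ 2.

Section Lift.
Variable F : (V -> C) -> V -> C.
Hypothesis FD : forall f g x, F (fun y => (f y + g y)%C) x = (F f x + F g x)%C.
Hypothesis FZ : forall (k : C) f x, F (fun y => (k * f y)%C) x = (k * F f x)%C.
Hypothesis FB : sq_bounded F.

Lemma lift_summable (f : l2 V) : square_summable (F f).
Proof.
  destruct FB as (K & HK & H). exists ((K * l2_norm f) ^ 2). intros s Hs.
  apply H; auto using l2_norm_ge0, sqsum_le_norm.
Qed.

Lemma lift_linear : is_linear (fun f : l2 V => L2 (lift_summable f)).
Proof.
  split.
  - intros f g; apply l2_eq; intros x; simpl; apply FD.
  - intros k f; apply l2_eq; intros x; simpl; apply FZ.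
  - destruct FB as (K & HK & H). exists K; split; auto. intros f.
    apply l2_norm_le.
    + apply Rmult_le_pos; [lra|apply l2_norm_ge0].
    + intros s Hs. simpl l2_fun.
      apply H; auto using sqsum_le_norm. apply l2_norm_ge0.
Qed.

Definition lift : Op := Bop lift_linear.

End Lift.

Lemma lift_Cmod_le F : sq_bounded F -> forall G,
  (forall f x, Cmod (G f x) <= Cmod (F f x)) -> sq_bounded G.
Proof.
  intros (K & HK & H) G HG. exists K; split; auto. intros f B HB Hf s Hs.
  eapply Rle_trans; [|apply (H f B HB Hf s Hs)].
  apply rsum_le; intros x _. apply pow_incr; split; auto using Cmod_ge_0.
Qed.

Lemma adj_bound (h : V -> R) B :
  (forall x, 0 <= h x) ->
  (forall s, NoDup s -> rsum s (fun x => h x ^ 2) <= B) ->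
  forall s, NoDup s ->
    rsum s (fun x => rsum (star x) (fun e => h (ter e)) ^ 2)
      <= INR (maxdeg X) ^ 2 * B.
Proof.
  intros Hh HB s Hs. pose proof (pos_INR (maxdeg X)) as HM.
  set (M := INR (maxdeg X)) in *.
  assert (Hdeg : forall x : V, INR (length (star x)) <= M)
    by (intros x; apply le_INR, maxdeg_ub).
  set (L := flat_map (fun x : V => star x) s).
  assert (HL : NoDup L).
  { unfold L; clear -Hs. induction Hs as [|x s Hx Hs IH]; simpl; [constructor|].
    apply NoDup_app; auto using star_NoDup.
    intros e He He'. apply in_flat_map in He'. destruct He' as (y & Hy & He').
    apply In_star in He. apply In_star in He'. congruence. }
  assert (H1 : rsum s (fun x => rsum (star x) (fun e => h (ter e)) ^ 2)
               <= M * rsum L (fun e => h (ter e) ^ 2)).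
  { unfold L. rewrite rsum_flat_map, <- rsum_scal. apply rsum_le; intros x _.
    pose proof (rsum_cauchy_schwarz (star x) (fun _ => 1) (fun e => h (ter e))) as H.
    rewrite (rsum_const (1 ^ 2)), pow1, Rmult_1_r in H.
    rewrite (rsum_ext (g := fun e => h (ter e))) in H by (intros; ring).
    eapply Rle_trans; [apply H|]. apply Rmult_le_compat_r; auto.
    apply rsum_ge0; intros; apply pow2_ge_0. }
  set (T := nodup (fun x y : V => excluded_middle_informative (x = y))
              (map (fun e => ter e) L)).
  assert (H2 : rsum L (fun e => h (ter e) ^ 2)
    <= rsum (flat_map (fun y => map (@einv X) (star y)) T)
         (fun e => h (ter e) ^ 2)).
  { apply rsum_incl; auto; [intros; apply pow2_ge_0|].
    intros e He. apply in_flat_map. exists (ter e). split.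
    - apply nodup_In. apply in_map_iff. exists e; auto.
    - apply in_map_iff. exists (einv e). split; [apply einvK|].
      apply In_star, orig_einv. }
  assert (H3 : rsum (flat_map (fun y => map (@einv X) (star y)) T)
         (fun e => h (ter e) ^ 2) <= M * rsum T (fun y => h y ^ 2)).
  { rewrite rsum_flat_map, <- rsum_scal. apply rsum_le; intros y _.
    rewrite rsum_map. rewrite (rsum_ext (g := fun _ => h y ^ 2)).
    - rewrite rsum_const. apply Rmult_le_compat_r; auto using pow2_ge_0.
    - intros e He. apply In_star in He. rewrite ter_einv, He; auto. }
  assert (H4 : rsum T (fun y => h y ^ 2) <= B) by (apply HB, NoDup_nodup).
  assert (H5 : M * rsum T (fun y => h y ^ 2) <= M * B)
    by (apply Rmult_le_compat_l; auto).
  replace (M ^ 2 * B) with (M * (M * B)) by ring.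
  eapply Rle_trans; [apply H1|]. apply Rmult_le_compat_l; auto. lra.
Qed.

Lemma paths_bound (h : V -> R) B m :
  (forall x, 0 <= h x) ->
  (forall s, NoDup s -> rsum s (fun x => h x ^ 2) <= B) ->
  forall s, NoDup s ->
    rsum s (fun x => rsum (paths m x) (fun c => h (path_ter x c)) ^ 2)
      <= (INR (maxdeg X) ^ 2) ^ m * B.
Proof.
  intros Hh HB; induction m as [|m IH]; intros s Hs.
  - simpl pow at 2. rewrite Rmult_1_l.
    eapply Rle_trans; [|apply (HB s Hs)].
    apply rsum_le; intros x _; simpl; right; ring.
  - pose proof (@adj_bound
      (fun x => rsum (paths m x) (fun c => h (path_ter x c)))
      ((INR (maxdeg X) ^ 2) ^ m * B)
      (fun x => rsum_ge0 _ (fun c => Hh (path_ter x c))) IH s Hs) as H.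
    eapply Rle_trans; [|eapply Rle_trans; [apply H|]].
    + apply rsum_le; intros x _. right; f_equal. simpl paths.
      rewrite rsum_flat_map. apply rsum_ext; intros e _.
      rewrite rsum_map; auto.
    + simpl; right; ring.
Qed.

Definition bounded_fun (g : V -> C) : Prop :=
  exists K, forall x, Cmod (g x) <= K.

Lemma mulop_bounded g : bounded_fun g ->
  sq_bounded (fun f x => (g x * f x)%C).
Proof.
  intros (K & HK). exists (Rmax K 1).
  assert (H1 : 1 <= Rmax K 1) by apply Rmax_r. split; [lra|].
  intros f B HB Hf s Hs. rewrite Rpow_mult_distr.
  eapply Rle_trans; [|apply Rmult_le_compat_l; [apply pow2_ge_0|apply (Hf s Hs)]].
  unfold sqsum; rewrite <- rsum_scal. apply rsum_le; intros x _.
  rewrite Cmod_mult, Rpow_mult_distr. apply Rmult_le_compat_r; [apply pow2_ge_0|].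
  apply pow_incr; split; [apply Cmod_ge_0|].
  eapply Rle_trans; [apply HK|apply Rmax_l].
Qed.

Lemma mulop_scal (g : V -> C) (k : C) f x :
  (g x * (k * f x) = k * (g x * f x))%C.
Proof. ring. Qed.

Definition mulop (g : V -> C) (Hg : bounded_fun g) : Op :=
  @lift (fun f x => (g x * f x)%C)
    (fun f h x => Cmult_plus_distr_l (g x) (f x) (h x))
    (mulop_scal g) (mulop_bounded Hg).

Lemma A_bounded : sq_bounded (fun f x => csum (star x) (fun e => f (ter e))).
Proof.
  exists (INR (maxdeg X) + 1). pose proof (pos_INR (maxdeg X)).
  split; [lra|]. intros f B HB Hf s Hs.
  eapply Rle_trans; [|eapply Rle_trans; [apply (@adj_bound (fun x => Cmod (f x))
    (B ^ 2) (fun x => Cmod_ge_0 (f x)) Hf s Hs)|]].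
  - apply rsum_le; intros x _. apply pow_incr; split; [apply Cmod_ge_0|].
    apply csum_Cmod.
  - rewrite Rpow_mult_distr. apply Rmult_le_compat_r; [apply pow2_ge_0|].
    apply pow_incr; lra.
Qed.

Definition A_X : Op :=
  @lift (fun f x => csum (star x) (fun e => f (ter e)))
    (fun f g x => csum_plus _ _ _) (fun k f x => csum_scal _ _ _) A_bounded.

Lemma deg_bounded : bounded_fun (fun x => RtoC (INR (deg x))).
Proof.
  exists (INR (maxdeg X)). intros x. rewrite Cmod_R, Rabs_pos_eq by apply pos_INR.
  apply le_INR, maxdeg_ub.
Qed.

Definition I_X : Op := one.

Definition D_X : Op := mulop deg_bounded.

Definition Delta_X : Op := (D_X - A_X)%op.

Definition Q_X (t : C) : Op := (D_X - (1 - t) *: I_X)%op.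

Definition f_X (t z : C) : Op := (z *: A_X - (z ^ 2 * (1 - t)) *: Q_X t)%op.

Definition kronecker (x0 x : V) : C :=
  if excluded_middle_informative (x0 = x) then 1%C else 0%C.

Lemma kronecker_bound x0 s : NoDup s -> sqsum (kronecker x0) s <= 1 ^ 2.
Proof.
  intros Hs. rewrite pow1. unfold sqsum. induction Hs as [|x s Hx Hs IH]; simpl; [lra|].
  unfold kronecker at 1 2. destruct (excluded_middle_informative _) as [<-|E].
  - rewrite Cmod_1.
    assert (H : rsum s (fun x => Cmod (kronecker x0 x) ^ 2) = 0).
    { rewrite (rsum_ext (g := fun _ => 0)); [rewrite rsum_const; ring|].
      intros y Hy. unfold kronecker.
      destruct (excluded_middle_informative _) as [<-|_]; [contradiction|].
      rewrite Cmod_0; ring. }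
    simpl in H; rewrite H; lra.
  - rewrite Cmod_0. simpl in IH; lra.
Qed.

Lemma kronecker_summable x0 : square_summable (kronecker x0).
Proof. exists (1 ^ 2); apply kronecker_bound. Qed.

Definition delta (x0 : V) : l2 V := L2 (kronecker_summable x0).

Definition entry (T : Op) (x1 x2 : V) : C := T (delta x1) x2.

Lemma entry_bounded (T : Op) : bounded_fun (fun x => entry T x x).
Proof.
  exists (bop_norm T). intros x. unfold entry.
  eapply Rle_trans; [apply Cmod_le_l2_norm|].
  apply (proj1 (bop_norm_lub T)).
  apply l2_norm_le; [lra|]. apply kronecker_bound.
Qed.

Definition C_fun (t : C) (m : nat) (f : V -> C) (x : V) : C :=
  csum (paths m x) (fun c => (t ^ bc c * f (path_ter x c))%C).

Lemma C_fun_plus t m f g x :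
  C_fun t m (fun y => (f y + g y)%C) x = (C_fun t m f x + C_fun t m g x)%C.
Proof.
  unfold C_fun. rewrite <- csum_plus. apply csum_ext; intros; ring.
Qed.

Lemma C_fun_scal t m k f x :
  C_fun t m (fun y => (k * f y)%C) x = (k * C_fun t m f x)%C.
Proof.
  unfold C_fun. rewrite <- csum_scal. apply csum_ext; intros; ring.
Qed.

Lemma bc_le_length (c : list (EX X)) : (bc c <= length c)%nat.
Proof.
  induction c as [|e1 [|e2 c] IH]; simpl in *; auto.
  destruct (excluded_middle_informative _); lia.
Qed.

Lemma Cmod_Cpow (t : C) n : Cmod (t ^ n) = Cmod t ^ n.
Proof.
  induction n as [|n IH]; simpl; [apply Cmod_1|]. rewrite Cmod_mult, IH; auto.
Qed.

Lemma C_fun_bounded t m : sq_bounded (C_fun t m).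
Proof.
  set (T := Rmax 1 (Cmod t)).
  assert (HT : 1 <= T) by apply Rmax_l.
  assert (HTm : 1 <= T ^ m) by (apply pow_R1_Rle; auto).
  set (M := INR (maxdeg X)). assert (HM : 0 <= M) by apply pos_INR.
  assert (HMm : 0 <= M ^ m) by (apply pow_le; auto).
  exists (T ^ m * (M ^ m + 1)). split; [apply Rmult_lt_0_compat; lra|].
  intros f B HB Hf s Hs.
  assert (H : forall x, Cmod (C_fun t m f x)
    <= T ^ m * rsum (paths m x) (fun c => Cmod (f (path_ter x c)))).
  { intros x. unfold C_fun. eapply Rle_trans; [apply csum_Cmod|].
    rewrite <- rsum_scal. apply rsum_le; intros c Hc.
    apply paths_spec in Hc. destruct Hc as [_ Hc].
    rewrite Cmod_mult, Cmod_Cpow. apply Rmult_le_compat_r; [apply Cmod_ge_0|].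
    apply Rle_trans with (T ^ bc c).
    - apply pow_incr; split; [apply Cmod_ge_0|apply Rmax_r].
    - apply Rle_pow; auto. rewrite <- Hc. apply bc_le_length. }
  apply Rle_trans with ((T ^ m) ^ 2 * ((M ^ 2) ^ m * B ^ 2)).
  - eapply Rle_trans; [|apply Rmult_le_compat_l; [apply pow2_ge_0|
      apply (@paths_bound (fun x => Cmod (f x)) (B ^ 2) m
        (fun x => Cmod_ge_0 (f x)) Hf s Hs)]].
    unfold sqsum. rewrite <- rsum_scal. apply rsum_le; intros x _.
    rewrite <- Rpow_mult_distr. apply pow_incr; split; [apply Cmod_ge_0|auto].
  - rewrite !Rpow_mult_distr, Rmult_assoc.
    apply Rmult_le_compat_l; [apply pow2_ge_0|].
    apply Rmult_le_compat_r; [apply pow2_ge_0|].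
    replace ((M ^ 2) ^ m) with ((M ^ m) ^ 2)
      by (rewrite <- !pow_mult; f_equal; lia).
    apply pow_incr; lra.
Qed.

Definition C_op (t : C) (m : nat) : Op :=
  lift (@C_fun_plus t m) (@C_fun_scal t m) (C_fun_bounded t m).

Definition Delta_c (t : C) (k : nat) (x : V) : C :=
  (RtoC (INR (deg x)) * entry (C_op t k) x x
   - csum (star x) (fun e => entry (C_op t k) (ter e) (ter e)))%C.

(** [ceil(m/2) - 1] *)
Definition jmax (m : nat) : nat := (Nat.div (m + 1) 2 - 1)%nat.

Definition R_fun (t : C) (m : nat) (x : V) : C :=
  sum_n_m (fun j => sum_n_m (fun i =>
    ((1 - t) ^ (2 * (j - i)) * (1 - t ^ 2) ^ (i - 1)
       * Delta_c t (m - 2 * j) x)%C) 1 j) 1 (jmax m).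

Lemma bounded_fun_plus g h : bounded_fun g -> bounded_fun h ->
  bounded_fun (fun x => (g x + h x)%C).
Proof.
  intros [K HK] [L HL]; exists (K + L); intros x.
  eapply Rle_trans; [apply Cmod_triangle|]. specialize (HK x); specialize (HL x); lra.
Qed.

Lemma bounded_fun_scal k g : bounded_fun g -> bounded_fun (fun x => (k * g x)%C).
Proof.
  intros [K HK]; exists (Cmod k * K); intros x. rewrite Cmod_mult.
  apply Rmult_le_compat_l; auto using Cmod_ge_0.
Qed.

Lemma bounded_fun_sum (g : nat -> V -> C) a b :
  (forall i, bounded_fun (g i)) -> bounded_fun (fun x => sum_n_m (fun i => g i x) a b).
Proof.
  intros H. destruct (Nat.le_gt_cases a b) as [Hab|Hab].
  - induction Hab as [|b Hab IH].
    + destruct (H a) as [K HK]; exists K; intros x. rewrite sum_n_n; auto.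
    + destruct (bounded_fun_plus IH (H (S b))) as [K HK].
      exists K; intros x. rewrite sum_n_Sm by lia. apply HK.
  - exists 0; intros x. rewrite sum_n_m_zero by auto.
    right; exact Cmod_0.
Qed.

Lemma Delta_c_bounded t k : bounded_fun (Delta_c t k).
Proof.
  destruct (entry_bounded (C_op t k)) as [K HK].
  exists (INR (maxdeg X) * K + INR (maxdeg X) * K). intros x.
  assert (Hd : INR (length (star x)) <= INR (maxdeg X))
    by (apply le_INR, maxdeg_ub).
  assert (HK0 : 0 <= K) by (eapply Rle_trans; [apply Cmod_ge_0|apply (HK x)]).
  unfold Delta_c, Cminus. eapply Rle_trans; [apply Cmod_triangle|].
  rewrite Cmod_mult, Cmod_opp, Cmod_R, Rabs_pos_eq by apply pos_INR.
  apply Rplus_le_compat.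
  - apply Rmult_le_compat; auto using pos_INR, Cmod_ge_0.
  - eapply Rle_trans; [apply csum_Cmod|].
    eapply Rle_trans; [apply rsum_le; intros e _; apply (HK (ter e))|].
    rewrite rsum_const. apply Rmult_le_compat_r; auto.
Qed.

Lemma R_fun_bounded t m : bounded_fun (R_fun t m).
Proof.
  apply bounded_fun_sum; intros j. apply bounded_fun_sum; intros i.
  apply bounded_fun_scal, Delta_c_bounded.
Qed.

Definition R_op (t : C) (m : nat) : Op := mulop (R_fun_bounded t m).

Definition Ccbc (t : C) (m : nat) : Op :=
  match m with
  | O | 1%nat => C_op t m
  | 2%nat => (t *: C_op t 2)%op
  | _ =>
    (C_op t m
     - (D_X - (2 * (1 - t)) *: I_X)
       * sum_n_m (fun j => (1 - t) ^ (2 * j - 1) *: C_op t (m - 2 * j)) 1 (jmax m)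
     + (1 - t) *: R_op t m
     - (if Nat.even m then (1 - t) ^ (m - 1) * t else 0) *: D_X)%op
  end.

(** The terms [C^cbc_m(t)(x0,x) u^m / m], [m = k + 1]. *)
Definition Z_term (u t : C) (x0 x : V) (k : nat) : C :=
  (entry (Ccbc t (k + 1)) x0 x / RtoC (INR (k + 1)) * u ^ (k + 1))%C.

Definition Z_X (u t : C) (x0 x : V) : C :=
  Cexp (series_sum (V := C_NormedModule) (Z_term u t x0 x)).

Definition alpha (t : C) : R :=
  (INR (maxdeg X) + sqrt (INR (maxdeg X) ^ 2 + 4 * (Cmod t + 1) * INR (maxdeg X)))
  / 2.

(** The terms [n >= 2] of the series in the integrand, with [n = k + 2]. *)
Definition comm_term (t : C) (x0 x : V) (z : C) (k : nat) : C :=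
  let n := (k + 2)%nat in
  (/ RtoC (INR n)
   * sum_n_m (fun j =>
       RtoC (INR j)
       * entry (f_X t z ^ (n - 1 - j) * (A_X * D_X - D_X * A_X)
                * f_X t z ^ (j - 1))%op x0 x) 1 (n - 1))%C.

Definition integrand (t : C) (x0 x : V) (z : C) : C :=
  ((1 - t) * z ^ 2 * series_sum (V := C_NormedModule) (comm_term t x0 x z))%C.

(** The terms [m >= 3] of the last series, with [m = k + 3]. *)
Definition R_term (u t : C) (x0 x : V) (k : nat) : C :=
  ((1 - t) * entry (R_op t (k + 3)) x0 x / RtoC (INR (k + 3)) * u ^ (k + 3))%C.

End BoundedGraphOperators.

Arguments A_X : clear implicits.
Arguments I_X : clear implicits.
Arguments D_X : clear implicits.
Arguments Delta_X : clear implicits.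
Arguments Q_X : clear implicits.
Arguments f_X : clear implicits.
Arguments C_op : clear implicits.
Arguments R_op : clear implicits.
Arguments Ccbc : clear implicits.
Arguments Z_X : clear implicits.
Arguments alpha : clear implicits.

(* Main.v *)
(** Write [f(z) = z A - z^2 (1-t) Q] and [w = (1-t)^2 z^2]. Splitting off the first
    edge of a path gives [C_m = A C_(m-1) - (1-t) Q C_(m-2)] for [m >= 3], so that
    [G(z) = sum_m C_m z^m] satisfies [(1 - f(z)) G(z) = 1 - w]; as [alpha] is the positive
    root of [a^2 = M a + (1+|t|) M], the norms [||C_m||] are at most [alpha^m] and
    [||f(z)|| < 1] for [|z| < 1/alpha]. Let [S_m] be [C^cbc_m] without its [R_m] term.
    Summing the geometric factors, the entries satisfy
    [sum_m S_m z^m = z f'(z) (1 - f(z))^-1 + (D - 2) w / (1 - w)].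
    Since [f'f - ff' = z^2 (1-t) (AD - DA)], moving [f'] to the left in the derivative of
    [f^n / n] leaves [f' f^(n-1)] minus the commutator terms of the statement.
    Dividing by [z] and integrating from [0] to [u] termwise (Weierstrass M-test) turns
    the two summands on the right into the logarithm, the integral and the power;
    [m = 2] and the [R_m] account for the last two exponentials. *)

From Stdlib Require Import Lra Lia FunctionalExtensionality ClassicalEpsilon.
Require Import Defs.

(** * Series and integrals of complex-valued functions *)

(** The inverse of [1 - f(z)] is never formed. The vector [G(z) delta] satisfies a fixed-point
    equation, and evaluated at [x] this equation expresses the only non-local quantity, the value of
    [z A G(z) delta], by diagonal operators. So the entry of [z f'(z) (1 - f(z))^-1] is a function
    of the scalar [G(z)(x0,x)] and of [deg x], and the comparison with the [S_m] becomes scalar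
    algebra. The coefficients in [Ccbc] are tuned to it: [D - 2(1-t)] turns the factor [1 - w] into
    [1 - z^2 (1-t)(D - (1-t))], the factor produced by [f'], and the summand [t D] for even [m]
    leaves [(D - 2) w / (1 - w)]. Connectedness enters through [deg >= 1], which gives [||Q|| <= M].
    Then the constants [M] and [(1+|t|) M] bound both the recursion for [C_m] and the operator
    [f(z)], so that a single [alpha] governs both. Dividing by [z] excludes the end [s = 0] of the
    segment; termwise integration is therefore set up with conditions on the open interval. *)

Section NormedSeries.
Context {K : AbsRing} {V : NormedModule K}.
Implicit Types (a : nat -> V) (l : V) (b : nat -> R).

Lemma norm_minus_self (x : V) : norm (minus x x) = 0.
Proof.
  transitivity (norm (zero : V)); [f_equal; apply @minus_eq_zero|apply norm_zero].
Qed.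

Lemma norm_minus_sym (x y : V) : norm (minus x y) = norm (minus y x).
Proof. rewrite <- norm_opp. f_equal. apply @opp_minus. Qed.

Lemma is_series_norm a l :
  is_series a l <->
  forall eps, 0 < eps ->
    exists N, forall n, (N <= n)%nat -> norm (minus (sum_n a n) l) < eps.
Proof.
  split.
  - intros H eps He.
    apply (proj1 (filterlim_locally_ball_norm _ _) H (mkposreal eps He)).
  - intros H. apply (filterlim_locally_ball_norm (F := eventually)).
    intros eps. apply (H eps), cond_pos.
Qed.

Lemma is_series_inj a l1 l2 : is_series a l1 -> is_series a l2 -> l1 = l2.
Proof. apply filterlim_locally_unique. Qed.

(** [series_sum] picks a sum by [epsilon]; since limits are unique, exhibiting any sum identifies
    it. *)
Lemma series_sum_unique a l : is_series a l -> series_sum a = l.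
Proof.
  intros H. apply (is_series_inj a); auto.
  apply (@ClassicalEpsilon.epsilon_spec V (inhabits zero) (fun l => is_series a l)).
  exists l; auto.
Qed.

Lemma is_series_norm_le a l y N r :
  is_series a l ->
  (forall n, (N <= n)%nat -> norm (minus (sum_n a n) y) <= r) ->
  norm (minus l y) <= r.
Proof.
  intros Ha H. apply Rnot_lt_le; intros Hr.
  destruct (proj1 (is_series_norm a l) Ha (norm (minus l y) - r)) as [M HM]; [lra|].
  specialize (HM (Nat.max N M) (Nat.le_max_r _ _)).
  specialize (H (Nat.max N M) (Nat.le_max_l _ _)).
  assert (E : norm (minus l y) <= norm (minus l (sum_n a (Nat.max N M)))
    + norm (minus (sum_n a (Nat.max N M)) y))
    by (rewrite (minus_trans (sum_n a (Nat.max N M))); apply @norm_triangle).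
  assert (E' : norm (minus l (sum_n a (Nat.max N M)))
     = norm (minus (sum_n a (Nat.max N M)) l))
    by apply norm_minus_sym.
  lra.
Qed.

Lemma sum_n_diff_norm_le a b n m :
  (forall k, norm (a k) <= b k) -> (n <= m)%nat ->
  norm (minus (sum_n a m) (sum_n a n)) <= sum_n b m - sum_n b n.
Proof.
  intros H; induction 1 as [|m Hm IH].
  - rewrite norm_minus_self; lra.
  - rewrite !sum_Sn. change (plus (sum_n b m) (b (S m))) with (sum_n b m + b (S m)).
    assert (E : minus (plus (sum_n a m) (a (S m))) (sum_n a n)
      = plus (minus (sum_n a m) (sum_n a n)) (a (S m))).
    { unfold minus. etransitivity; [symmetry; apply @plus_assoc|].
      etransitivity; [|apply @plus_assoc]. f_equal. apply @plus_comm. }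
    rewrite E. eapply Rle_trans; [apply norm_triangle|]. specialize (H (S m)). lra.
Qed.

Lemma sum_n_le_series b B n :
  (forall k, 0 <= b k) -> is_series b B -> sum_n b n <= B.
Proof.
  intros H HB. apply Rnot_lt_le; intros Hr.
  destruct (proj1 (@is_series_Reals b B) HB (sum_n b n - B)) as [M HM]; [lra|].
  specialize (HM (Nat.max n M) (Nat.le_max_r _ _)).
  rewrite <- sum_n_Reals in HM. apply Rabs_def2 in HM.
  enough (sum_n b n <= sum_n b (Nat.max n M)) by lra.
  generalize (Nat.le_max_l n M). generalize (Nat.max n M). clear -H.
  induction 1 as [|m Hm IH]; [lra|]. rewrite sum_Sn.
  change (sum_n b n <= sum_n b m + b (S m)). specialize (H (S m)); lra.
Qed.

(** The bound depends on the terms only through the majorant [b]; this uniformity is what the M-test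
    uses. *)
Lemma series_tail_norm_le a l b B n :
  is_series a l -> (forall k, norm (a k) <= b k) -> is_series b B ->
  norm (minus l (sum_n a n)) <= B - sum_n b n.
Proof.
  intros Ha H HB. apply (is_series_norm_le a l _ n); auto.
  intros m Hm. eapply Rle_trans; [apply (sum_n_diff_norm_le _ b); auto|].
  enough (sum_n b m <= B) by lra. apply sum_n_le_series; auto.
  intros k; eapply Rle_trans; [apply (norm_ge_0 (a k))|apply H].
Qed.

Lemma is_series_tail_eps b B eps :
  is_series b B -> 0 < eps -> exists N, forall n, (N <= n)%nat -> B - sum_n b n < eps.
Proof.
  intros H He. destruct (proj1 (@is_series_Reals b B) H eps He) as [N HN].
  exists N; intros n Hn. specialize (HN n Hn). rewrite <- sum_n_Reals in HN.
  apply Rabs_def2 in HN; lra.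
Qed.

End NormedSeries.

Local Notation "a ~~> l" := (@is_series C_AbsRing C_NormedModule a l) (at level 70).

Lemma ex_series_C_le (a : nat -> C) (b : nat -> R) :
  (forall n, Cmod (a n) <= b n) -> ex_series b -> exists l : C, a ~~> l.
Proof.
  intros H Hb.
  exact (@ex_series_le C_AbsRing C_CompleteNormedModule a b H Hb).
Qed.

Lemma is_series_C_plus (a b : nat -> C) (la lb : C) :
  a ~~> la -> b ~~> lb -> (fun n => (a n + b n)%C) ~~> (la + lb)%C.
Proof. apply (@is_series_plus C_AbsRing C_NormedModule). Qed.

Lemma is_series_C_scal (c : C) (a : nat -> C) (la : C) :
  a ~~> la -> (fun n => (c * a n)%C) ~~> (c * la)%C.
Proof. apply (@is_series_scal C_AbsRing C_NormedModule). Qed.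

Lemma is_series_C_shift (a : nat -> C) (l : C) :
  a ~~> l -> (fun n => match n with O => RtoC 0 | S m => a m end) ~~> l.
Proof.
  intros H. apply (@is_series_decr_1 C_AbsRing C_NormedModule).
  change (a ~~> (l + - 0)%C). replace (l + - 0)%C with l by ring. auto.
Qed.

Lemma is_series_C_ext (a b : nat -> C) (l : C) :
  (forall n, a n = b n) -> a ~~> l -> b ~~> l.
Proof. apply (@is_series_ext C_AbsRing C_NormedModule). Qed.

Local Notation C_is_RInt := (is_RInt (V := C_R_NormedModule)).

Lemma is_RInt_C_plus (f g : R -> C) a b (lf lg : C) :
  C_is_RInt f a b lf -> C_is_RInt g a b lg ->
  C_is_RInt (fun s => (f s + g s)%C) a b (lf + lg)%C.
Proof. apply (@is_RInt_plus C_R_NormedModule). Qed.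

(** [C_R_NormedModule] is a module over the reals, so a complex factor is not its [scal]; real and
    imaginary parts are integrated separately. *)
Lemma is_RInt_C_scal (c : C) (f : R -> C) a b (l : C) :
  C_is_RInt f a b l -> C_is_RInt (fun s => (c * f s)%C) a b (c * l)%C.
Proof.
  intros H.
  apply (is_RInt_fct_extend_pair (U := R_NormedModule) (V := R_NormedModule)).
  - apply (is_RInt_minus (V := R_NormedModule)); apply (is_RInt_scal (V := R_NormedModule)).
    + apply (is_RInt_fct_extend_fst _ _ _ _ H).
    + apply (is_RInt_fct_extend_snd _ _ _ _ H).
  - apply (is_RInt_plus (V := R_NormedModule)); apply (is_RInt_scal (V := R_NormedModule)).
    + apply (is_RInt_fct_extend_snd _ _ _ _ H).
    + apply (is_RInt_fct_extend_fst _ _ _ _ H).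
Qed.

Lemma is_RInt_RtoC f a b (l : R) :
  is_RInt f a b l -> C_is_RInt (fun s => RtoC (f s)) a b (RtoC l).
Proof.
  intros H.
  apply (is_RInt_fct_extend_pair (U := R_NormedModule) (V := R_NormedModule)); auto.
  pose proof (is_RInt_const (V := R_NormedModule) a b 0) as H0.
  change (scal (b - a) 0) with ((b - a) * 0) in H0. rewrite Rmult_0_r in H0. exact H0.
Qed.

(** Weierstrass M-test. *)
Lemma is_RInt_series (a : nat -> R -> C) (I : nat -> C) (g : R -> C) (b : nat -> R) :
  (forall n, C_is_RInt (a n) 0 1 (I n)) ->
  (forall n s, 0 < s < 1 -> Cmod (a n s) <= b n) -> ex_series b ->
  (forall s, 0 < s < 1 -> (fun n => a n s) ~~> g s) ->
  exists l, I ~~> l /\ C_is_RInt g 0 1 l.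
Proof.
  intros HI Hb [B HB] Hg.
  (* [filterlim_RInt] asks for uniform convergence on the whole line, while the majorant holds on
     the open interval; cutting off by 0 gives the former without changing the integrals. *)
  pose (cut := fun (h : R -> C) s => if Rlt_dec 0 s then
    if Rlt_dec s 1 then h s else RtoC 0 else RtoC 0).
  assert (Hcut : forall h s, Rmin 0 1 < s < Rmax 0 1 -> cut h s = h s).
  { intros h s. rewrite Rmin_left, Rmax_right by lra. unfold cut. intros Hs.
    destruct (Rlt_dec 0 s); [|lra]. destruct (Rlt_dec s 1); [auto|lra]. }
  destruct (@filterlim_RInt nat C_R_CompleteNormedModule
    (fun n s => sum_n (fun k => cut (a k) s) n) 0 1 eventually eventually_filter
    (cut g) (fun n => sum_n I n)) as (l & Hl & Hint).
  - intros n. induction n as [|n IH].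
    + rewrite sum_O. eapply is_RInt_ext; [|apply (HI 0%nat)].
      intros s Hs. rewrite sum_O. symmetry; apply Hcut; auto.
    + rewrite sum_Sn.
      eapply is_RInt_ext; [|apply (is_RInt_C_plus _ _ _ _ _ _ IH (HI (S n)))].
      intros s Hs. rewrite sum_Sn. rewrite Hcut by auto. reflexivity.
  - apply filterlim_locally. intros eps.
    destruct (is_series_tail_eps b B eps HB (cond_pos eps)) as [N HN].
    exists N. intros n Hn s. apply (@norm_compat1 C_AbsRing C_NormedModule).
    unfold cut. destruct (Rlt_dec 0 s); [destruct (Rlt_dec s 1)|].
    + rewrite norm_minus_sym.
      eapply Rle_lt_trans; [|apply (HN n Hn)].
      apply (series_tail_norm_le (V := C_NormedModule) (fun k => a k s));
        [apply Hg; auto|intros k; apply Hb; auto|exact HB].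
    + replace (sum_n (fun _ => RtoC 0) n) with (RtoC 0).
      * rewrite norm_minus_self. apply cond_pos.
      * symmetry. apply (sum_n_m_const_zero (G := C_AbelianGroup)).
    + replace (sum_n (fun _ => RtoC 0) n) with (RtoC 0).
      * rewrite norm_minus_self. apply cond_pos.
      * symmetry. apply (sum_n_m_const_zero (G := C_AbelianGroup)).
  - exists l. split; [exact Hl|].
    eapply is_RInt_ext; [|apply Hint]. intros s Hs; apply Hcut; auto.
Qed.

(** * Exponential and principal logarithm *)

Lemma Cexp_plus a b : Cexp (a + b) = (Cexp a * Cexp b)%C.
Proof.
  destruct a as [a a'], b as [b b']. unfold Cexp, Cmult, Re, Im, RtoC; simpl.
  rewrite exp_plus, cos_plus, sin_plus. f_equal; ring.
Qed.

(** Trading the [acos] of [Carg] and its case distinction for one [atan] makes the logarithm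
    differentiable by formula in the right half-plane. *)
Lemma Clog_atan a b : 0 < a -> Clog (a, b) = (ln (a ^ 2 + b ^ 2) / 2, atan (b / a)).
Proof.
  intros Ha. unfold Clog, Carg, Cmod, Re, Im; simpl fst; simpl snd.
  set (r := a ^ 2 + b ^ 2). assert (Hr : 0 < r) by (unfold r; nra).
  assert (Hs : 0 < sqrt r) by (apply sqrt_lt_R0; auto).
  assert (Hss : sqrt r * sqrt r = r) by (apply sqrt_sqrt; lra).
  f_equal.
  - rewrite <- Hss at 2. rewrite ln_mult by auto. field.
  - assert (E : acos (a / sqrt r) = atan (Rabs b / a)).
    { rewrite acos_atan by (apply Rdiv_lt_0_compat; auto). f_equal.
      replace (1 - (a / sqrt r)²) with ((Rabs b / sqrt r)²).
      - rewrite sqrt_Rsqr; [field; lra|].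
        apply Rdiv_le_0_compat; auto using Rabs_pos.
      - assert (Hb := Rsqr_abs b). unfold Rsqr in *.
        apply (Rmult_eq_reg_r (sqrt r * sqrt r)); [|nra]. field_simplify; try lra.
        rewrite <- Rsqr_pow2, <- Rsqr_abs, Rsqr_pow2.
        rewrite pow2_sqrt by lra. unfold r; ring. }
    rewrite E. destruct (Rle_dec 0 b).
    + rewrite Rabs_pos_eq; auto.
    + rewrite Rabs_left by lra. rewrite <- atan_opp. f_equal. field; lra.
Qed.

(** The integrand is the derivative of [log (1 - w s^2)], which vanishes at [s = 0]. For [|w| < 1]
    the points [1 - w s^2] stay in the right half-plane, away from the branch cut. *)
Lemma Clog_integral w : Cmod w < 1 ->
  C_is_RInt (fun s => (- 2 * w * RtoC s / (1 - w * RtoC s ^ 2))%C) 0 1 (Clog (1 - w)).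
Proof.
  destruct w as [a b]. intros Hw.
  assert (Ha : a < 1).
  { eapply Rle_lt_trans; [apply Rle_abs|]. eapply Rle_lt_trans; [|apply Hw].
    apply (re_le_Cmod (a, b)). }
  assert (Hp : forall s, 0 <= s <= 1 -> 0 < 1 - a * s ^ 2).
  { intros s Hs. assert (0 <= s ^ 2 <= 1) by (split; nra).
    destruct (Rle_dec 0 a); nra. }
  replace (1 - (a, b))%C with ((1 - a, - b) : C)
    by (unfold Cminus, Cplus, Copp, RtoC; simpl; f_equal; ring).
  rewrite Clog_atan by lra.
  apply (is_RInt_fct_extend_pair (U := R_NormedModule) (V := R_NormedModule)).
  - replace (ln ((1 - a) ^ 2 + (- b) ^ 2) / 2) with
      (minus (ln ((1 - a * 1 ^ 2) ^ 2 + (b * 1 ^ 2) ^ 2) / 2)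
         (ln ((1 - a * 0 ^ 2) ^ 2 + (b * 0 ^ 2) ^ 2) / 2)).
    2: { replace ((1 - a * 1 ^ 2) ^ 2 + (b * 1 ^ 2) ^ 2)
           with ((1 - a) ^ 2 + (- b) ^ 2) by ring.
         replace ((1 - a * 0 ^ 2) ^ 2 + (b * 0 ^ 2) ^ 2) with 1 by ring.
         rewrite ln_1. unfold minus, plus, opp; simpl. lra. }
    apply (is_RInt_derive (V := R_CompleteNormedModule)
      (fun s => ln ((1 - a * s ^ 2) ^ 2 + (b * s ^ 2) ^ 2) / 2)).
    + rewrite Rmin_left, Rmax_right by lra. intros s Hs. specialize (Hp s Hs).
      assert (0 < (1 - a * s ^ 2) ^ 2 + (b * s ^ 2) ^ 2) by nra.
      auto_derive; [nra|]. simpl. field. nra.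
    + rewrite Rmin_left, Rmax_right by lra. intros s Hs. specialize (Hp s Hs).
      apply (@ex_derive_continuous R_AbsRing R_NormedModule). simpl.
      assert (0 < (1 - a * s ^ 2) ^ 2 + (b * s ^ 2) ^ 2) by nra.
      auto_derive. nra.
  - replace (atan (- b / (1 - a))) with
      (minus (atan (- (b * 1 ^ 2) / (1 - a * 1 ^ 2)))
         (atan (- (b * 0 ^ 2) / (1 - a * 0 ^ 2)))).
    2: { replace (- (b * 0 ^ 2) / (1 - a * 0 ^ 2)) with 0 by field.
         replace (- (b * 1 ^ 2)) with (- b) by ring.
         replace (1 - a * 1 ^ 2) with (1 - a) by ring.
         rewrite atan_0. unfold minus, plus, opp; simpl. lra. }
    apply (is_RInt_derive (V := R_CompleteNormedModule)
      (fun s => atan (- (b * s ^ 2) / (1 - a * s ^ 2)))).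
    + rewrite Rmin_left, Rmax_right by lra. intros s Hs. specialize (Hp s Hs).
      assert (0 < (1 - a * s ^ 2) ^ 2 + (b * s ^ 2) ^ 2) by nra.
      auto_derive; [nra|]. simpl. field. nra.
    + rewrite Rmin_left, Rmax_right by lra. intros s Hs. specialize (Hp s Hs).
      apply (@ex_derive_continuous R_AbsRing R_NormedModule). simpl.
      assert (0 < (1 - a * s ^ 2) ^ 2 + (b * s ^ 2) ^ 2) by nra.
      auto_derive. nra.
Qed.

(** * Bounded operators on l2 *)

Section OperatorNorm.
Context {U : NormedModule C_AbsRing}.
Implicit Types S T : bop U.

Lemma bop_norm_mult S T : bop_norm (mult S T) <= bop_norm S * bop_norm T.
Proof.
  apply bop_norm_le; intros x Hx. simpl.
  eapply Rle_trans; [apply norm_bop_le|].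
  apply Rmult_le_compat_l; [apply bop_norm_ge0|].
  apply bop_norm_lub; auto.
Qed.

Lemma bop_norm_pow T n r : bop_norm T <= r -> bop_norm (pow_n T n) <= r ^ n.
Proof.
  intros H. induction n as [|n IH].
  - apply bop_norm_le; auto.
  - simpl. eapply Rle_trans; [apply bop_norm_mult|].
    apply Rmult_le_compat; auto using bop_norm_ge0.
Qed.

End OperatorNorm.

Section L2Operators.
Variable V : Type.
Notation Op := (bop (l2_NormedModule V)).
Implicit Types (T S : Op) (f g : l2 V).

Lemma bop_apply_plus T f g x : T (plus f g) x = (T f x + T g x)%C.
Proof. rewrite (linear_plus _ (bop_linear T)). reflexivity. Qed.

Lemma bop_apply_scal T (k : C) f x : T (scal k f) x = (k * T f x)%C.
Proof. rewrite (linear_scal _ (bop_linear T)). reflexivity. Qed.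

Lemma bop_apply_le T f x : Cmod (T f x) <= bop_norm T * l2_norm f.
Proof.
  eapply Rle_trans; [apply Cmod_le_l2_norm|]. apply (norm_bop_le T (f : l2_NormedModule V)).
Qed.

Lemma sum_n_m_apply (a : nat -> Op) f x n m :
  (sum_n_m a n m : Op) f x = sum_n_m (fun k => a k f x) n m.
Proof.
  destruct (Nat.le_gt_cases n m) as [H|H].
  - induction H as [|m H IH].
    + rewrite !sum_n_n; auto.
    + rewrite !sum_n_Sm by lia. simpl. rewrite IH; auto.
  - rewrite !sum_n_m_zero by auto. reflexivity.
Qed.

Lemma sum_n_apply (a : nat -> Op) f x n :
  (sum_n a n : Op) f x = sum_n (fun k => a k f x) n.
Proof. apply sum_n_m_apply. Qed.

Lemma is_series_apply (a : nat -> Op) T f x :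
  is_series (V := bop_NormedModule (l2_NormedModule V)) a T ->
  (fun n => a n f x) ~~> T f x.
Proof.
  intros H. apply is_series_norm. intros eps He.
  assert (Hf := l2_norm_ge0 f).
  destruct (proj1 (is_series_norm a T) H (eps / (l2_norm f + 1))) as [N HN].
  { apply Rdiv_lt_0_compat; lra. }
  exists N; intros n Hn. specialize (HN n Hn). rewrite <- sum_n_apply.
  change (bop_norm (minus (sum_n a n : Op) T) < eps / (l2_norm f + 1)) in HN.
  change (Cmod ((minus (sum_n a n : Op) T : Op) f x) < eps).
  eapply Rle_lt_trans; [apply bop_apply_le|].
  apply Rle_lt_trans with (eps / (l2_norm f + 1) * l2_norm f).
  - apply Rmult_le_compat_r; lra.
  - apply Rlt_le_trans with (eps / (l2_norm f + 1) * (l2_norm f + 1)).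
    + apply Rmult_lt_compat_l; [apply Rdiv_lt_0_compat|]; lra.
    + right; field; lra.
Qed.

(** Norm bounds are tested on finite sums of squares, which are continuous under pointwise
    convergence; this carries bounds on partial sums over to a limit known only entrywise. *)
Lemma sqsum_limit_le (a : nat -> V -> C) (h : V -> C) N K s :
  (forall x, filterlim (fun n => a n x) eventually (locally (h x : C_NormedModule))) ->
  (forall n, (N <= n)%nat -> sqsum (a n) s <= K) -> sqsum h s <= K.
Proof.
  intros Ha HK.
  apply (is_lim_seq_le_loc (fun n => sqsum (a n) s) (fun _ => K)
    (Finite (sqsum h s)) (Finite K)).
  - exists N; auto.
  - clear HK. induction s as [|x s IH]; [apply is_lim_seq_const|].
    apply (is_lim_seq_plus' (fun n => Cmod (a n x) ^ 2) (fun n => sqsum (a n) s));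
      auto.
    assert (H : is_lim_seq (fun n => Cmod (a n x)) (Cmod (h x))).
    { apply (filterlim_comp _ _ _ _ _ _ _ _ (Ha x)).
      apply (@filterlim_norm C_AbsRing C_NormedModule). }
    change (is_lim_seq (fun n => Cmod (a n x) * (Cmod (a n x) * 1))
      (Finite (Cmod (h x) * (Cmod (h x) * 1)))).
    repeat apply is_lim_seq_mult'; auto. apply is_lim_seq_const.
  - apply is_lim_seq_const.
Qed.

Lemma sum_n_norm_le (a : nat -> Op) (b : nat -> R) B n :
  (forall k, bop_norm (a k) <= b k) -> is_series b B -> bop_norm (sum_n a n : Op) <= B.
Proof.
  intros Ha HB. apply Rle_trans with (sum_n b n).
  - induction n as [|n IH].
    + rewrite !sum_O; auto.
    + rewrite !sum_Sn. eapply Rle_trans; [apply bop_norm_triangle|].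
      apply Rplus_le_compat; auto.
  - apply sum_n_le_series; auto.
    intros k; eapply Rle_trans; [apply bop_norm_ge0|apply Ha].
Qed.

(** * Norm-convergent series of operators *)

Section Completeness.
Variables (a : nat -> Op) (b : nat -> R) (B : R).
Hypothesis Hab : forall n, bop_norm (a n) <= b n.
Hypothesis HB : is_series b B.

(** The limit is built entry by entry from absolutely convergent scalar series; linearity is
    inherited entrywise, boundedness from the partial sums. *)
Let lim f x : C := series_sum (V := C_NormedModule) (fun n => a n f x).

Lemma op_series_pointwise f x : (fun n => a n f x) ~~> lim f x.
Proof.
  unfold lim. destruct (ex_series_C_le (fun n => a n f x) (fun n => l2_norm f * b n))
    as [l Hl].
  - intros n. eapply Rle_trans; [apply bop_apply_le|]. rewrite Rmult_comm.
    apply Rmult_le_compat_l; auto using l2_norm_ge0.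
  - apply (ex_series_scal (l2_norm f) b). exists B; auto.
  - rewrite (series_sum_unique _ _ Hl); auto.
Qed.

Lemma op_series_partial f x :
  filterlim (fun n => (sum_n a n : Op) f x) eventually
    (locally (lim f x : C_NormedModule)).
Proof.
  eapply filterlim_ext; [|apply op_series_pointwise].
  intros n. symmetry; apply sum_n_apply.
Qed.

Lemma op_series_bound f s : NoDup s -> sqsum (lim f) s <= (B * l2_norm f) ^ 2.
Proof.
  intros Hs. apply (sqsum_limit_le _ _ 0%nat _ s (op_series_partial f)).
  intros n _. eapply Rle_trans; [apply sqsum_le_norm; auto|].
  apply pow_incr; split; [apply l2_norm_ge0|].
  eapply Rle_trans; [apply (norm_bop_le (sum_n a n : Op) (f : l2_NormedModule V))|].
  apply Rmult_le_compat_r; [apply l2_norm_ge0|]. apply (sum_n_norm_le _ b); auto.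
Qed.

Lemma op_series_bound_ge0 : 0 <= B.
Proof.
  eapply Rle_trans; [apply bop_norm_ge0|]. apply (sum_n_norm_le a b B 0); auto.
Qed.

Lemma op_series_summable f : square_summable (lim f).
Proof. exists ((B * l2_norm f) ^ 2). apply op_series_bound. Qed.

Lemma op_series_linear : is_linear (fun f : l2 V => L2 (op_series_summable f)).
Proof.
  split.
  - intros f g; apply l2_eq; intros x. simpl.
    apply (is_series_inj (V := C_NormedModule) (fun n => a n (plus f g) x));
      [apply op_series_pointwise|].
    eapply is_series_C_ext; [|apply is_series_C_plus; apply op_series_pointwise].
    intros n; simpl. symmetry; apply bop_apply_plus.
  - intros k f; apply l2_eq; intros x. simpl.
    apply (is_series_inj (V := C_NormedModule) (fun n => a n (scal k f) x));
      [apply op_series_pointwise|].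
    eapply is_series_C_ext; [|apply is_series_C_scal; apply op_series_pointwise].
    intros n; simpl. symmetry; apply bop_apply_scal.
  - exists (B + 1). pose proof op_series_bound_ge0. split; [lra|]. intros f.
    pose proof (l2_norm_ge0 f).
    apply Rle_trans with (B * l2_norm f).
    + apply l2_norm_le; [apply Rmult_le_pos; auto|]. apply op_series_bound.
    + apply Rmult_le_compat_r; auto; lra.
Qed.

(** For [m >= n] the partial sums [m] and [n] differ in norm by at most the tail of [b] after [n];
    letting [m] grow inside finite sums of squares bounds the distance to the limit. *)
Lemma ex_series_op : ex_series (V := bop_NormedModule (l2_NormedModule V)) a.
Proof.
  exists (Bop op_series_linear). apply is_series_norm. intros eps He.
  destruct (is_series_tail_eps b B eps HB He) as [N HN].
  exists N. intros n Hn. rewrite norm_minus_sym.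
  eapply Rle_lt_trans; [|apply (HN n Hn)].
  assert (Hb0 : forall k, 0 <= b k)
    by (intros k; eapply Rle_trans; [apply bop_norm_ge0|apply Hab]).
  assert (Ht : 0 <= B - sum_n b n)
    by (pose proof (sum_n_le_series b B n Hb0 HB); lra).
  apply bop_norm_le; intros f Hf. apply l2_norm_le; auto. intros s Hs.
  apply (sqsum_limit_le (fun m x => (minus (sum_n a m) (sum_n a n) : Op) f x) _ n).
  - intros x.
    apply (filterlim_comp_2 (G := locally (lim f x : C_NormedModule))
      (H := locally (opp ((sum_n a n : Op) f x) : C_NormedModule))
      (fun m => (sum_n a m : Op) f x) (fun _ => opp ((sum_n a n : Op) f x) : C) plus).
    + apply op_series_partial.
    + apply filterlim_const.
    + apply (@filterlim_plus C_AbsRing C_NormedModule).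
  - intros m Hm. eapply Rle_trans; [apply sqsum_le_norm; auto|].
    apply pow_incr; split; [apply l2_norm_ge0|].
    eapply Rle_trans;
      [apply (proj1 (bop_norm_lub (minus (sum_n a m) (sum_n a n) : Op)) f Hf)|].
    apply Rle_trans with (sum_n b m - sum_n b n).
    + apply (sum_n_diff_norm_le (V := bop_NormedModule (l2_NormedModule V)) a b); auto.
    + pose proof (sum_n_le_series b B m Hb0 HB); lra.
Qed.

End Completeness.
End L2Operators.

(** * Quadratic operator polynomials *)

Section OperatorIdentities.
Variable V : Type.
Notation Op := (bop (l2_NormedModule V)).
Implicit Types (T S : Op) (f g : l2 V).

Lemma bop_plusE T S f : (T + S)%op f = plus (T f) (S f).
Proof. reflexivity. Qed.
Lemma bop_oppE T f : (opp T : Op) f = opp (T f).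
Proof. reflexivity. Qed.
Lemma bop_minusE T S f : (T - S)%op f = plus (T f) (opp (S f)).
Proof. reflexivity. Qed.
Lemma bop_scalE k T f : (k *: T)%op f = scal (k : C) (T f).
Proof. reflexivity. Qed.
Lemma bop_multE T S f : (T * S)%op f = T (S f).
Proof. reflexivity. Qed.
Lemma bop_oneE f : (one : Op) f = f.
Proof. reflexivity. Qed.
Lemma bop_zeroE f : (zero : Op) f = zero.
Proof. reflexivity. Qed.
Lemma l2_plusE f g x : (plus f g : l2 V) x = (f x + g x)%C.
Proof. reflexivity. Qed.
Lemma l2_oppE f x : (opp f : l2 V) x = (- f x)%C.
Proof. reflexivity. Qed.
Lemma l2_scalE (k : C) f x : (scal k f : l2 V) x = (k * f x)%C.
Proof. reflexivity. Qed.
Lemma l2_zeroE x : (zero : l2 V) x = 0%C.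
Proof. reflexivity. Qed.
Lemma bop_linear_plus T f g : T (plus f g) = plus (T f) (T g).
Proof. apply (linear_plus _ (bop_linear T)). Qed.
Lemma bop_linear_scal T (k : C) f : T (scal k f) = scal k (T f).
Proof. apply (linear_scal _ (bop_linear T)). Qed.
Lemma bop_linear_opp T f : T (opp f) = opp (T f).
Proof. apply (linear_opp _ f (bop_linear T)). Qed.
Lemma bop_linear_zero T : T zero = zero.
Proof. apply (linear_zero _ (bop_linear T)). Qed.

End OperatorIdentities.

Ltac op_expand :=
  rewrite ?bop_minusE, ?bop_plusE, ?bop_oppE, ?bop_scalE, ?bop_multE, ?bop_oneE,
    ?bop_zeroE, ?bop_linear_plus, ?bop_linear_scal, ?bop_linear_opp, ?bop_linear_zero.

Ltac C_ring := match goal with |- ?a = ?b => change (@eq C a b); ring end.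

Ltac op_values := rewrite ?l2_plusE, ?l2_oppE, ?l2_scalE, ?l2_zeroE.

(** Applied to a vector, a product becomes a nested application, so the order of the factors
    survives the expansion by linearity, and [ring] meets only scalar entries. *)
Ltac op_ring :=
  let g := fresh "g" in let x := fresh "x" in
  apply bop_eq; intros g; repeat (progress op_expand);
  apply l2_eq; intros x; repeat (progress op_values); C_ring.

Section OperatorPolynomials.
Variable V : Type.
Notation Op := (bop (l2_NormedModule V)).

(** A formal derivative for polynomials with operator coefficients. Generation by monomials and sums
    lets the product rule and the integral formula be proved by induction. At [k = 0] the factor
    [INR 0] neutralises the truncated exponent [k - 1]. *)
Inductive op_poly_deriv : (C -> Op) -> (C -> Op) -> Prop :=
| op_poly_monomial k P :
    op_poly_deriv (fun z => (z ^ k) *: P)%op (fun z => (RtoC (INR k) * z ^ (k - 1)) *: P)%op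
| op_poly_plus F F' G G' : op_poly_deriv F F' -> op_poly_deriv G G' ->
    op_poly_deriv (fun z => F z + G z)%op (fun z => F' z + G' z)%op.

Lemma op_poly_ext F F' G G' :
  (forall z, F z = G z) -> (forall z, F' z = G' z) -> op_poly_deriv F F' -> op_poly_deriv G G'.
Proof.
  intros E E'. rewrite (functional_extensionality _ _ E).
  rewrite (functional_extensionality _ _ E'). auto.
Qed.

Lemma is_RInt_power k (u : C) :
  C_is_RInt (fun s => (RtoC (INR k) * (RtoC s * u) ^ (k - 1) * u)%C) 0 1
    (u ^ k - 0 ^ k)%C.
Proof.
  destruct k as [|k].
  - simpl. replace (1 - 1)%C with (0 * 0)%C by ring.
    eapply is_RInt_ext; [|apply (is_RInt_C_scal 0 (fun _ => RtoC 0))].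
    + intros s _; simpl. C_ring.
    + apply is_RInt_RtoC. pose proof (is_RInt_const (V := R_NormedModule) 0 1 0) as H.
      change (scal (1 - 0) 0) with ((1 - 0) * 0) in H.
      rewrite Rmult_0_r in H. exact H.
  - replace (u ^ S k - 0 ^ S k)%C with (u ^ S k * RtoC (1 ^ S k - 0 ^ S k))%C.
    2: { rewrite pow1, pow_i by lia. simpl. rewrite Rminus_0_r. ring. }
    eapply is_RInt_ext; [|apply (is_RInt_C_scal (u ^ S k)
      (fun s => RtoC (INR (S k) * s ^ k)))].
    + intros s _. replace (S k - 1)%nat with k by lia.
      rewrite RtoC_mult, RtoC_pow, Cpow_mult_l. rewrite Cpow_S. C_ring.
    + apply is_RInt_RtoC.
      apply (is_RInt_derive (V := R_CompleteNormedModule) (fun s => s ^ S k)).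
      * intros s _. rewrite <- (Rmult_1_r (INR (S k))).
        apply (is_derive_pow (fun s => s) (S k) s 1 (is_derive_id s)).
      * intros s _. apply (@ex_derive_continuous R_AbsRing R_NormedModule).
        auto_derive; auto.
Qed.

Lemma op_poly_is_RInt F F' (u : C) (v : l2 V) x : op_poly_deriv F F' ->
  C_is_RInt (fun s => (F' (RtoC s * u)%C v x * u)%C) 0 1 (F u v x - F 0 v x)%C.
Proof.
  induction 1 as [k P|F F' G G' _ IHF _ IHG].
  - replace (((u ^ k) *: P)%op v x - ((0 ^ k) *: P)%op v x)%C
      with (P v x * (u ^ k - 0 ^ k))%C by (op_expand; op_values; C_ring).
    eapply is_RInt_ext; [|apply (is_RInt_C_scal (P v x) _ _ _ _ (is_RInt_power k u))].
    intros s _. simpl. C_ring.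
  - replace ((F u + G u)%op v x - (F 0%C + G 0%C)%op v x)%C
      with ((F u v x - F 0 v x) + (G u v x - G 0 v x))%C by (op_expand; op_values; C_ring).
    eapply is_RInt_ext; [|apply (is_RInt_C_plus _ _ _ _ _ _ IHF IHG)].
    intros s _. simpl. C_ring.
Qed.

Variables (A Q : Op) (c : C).

Definition quad (z : C) : Op := (z *: A - (z ^ 2 * c) *: Q)%op.
Definition dquad (z : C) : Op := (A - (2 * z * c) *: Q)%op.

(** Left multiplication by [quad z] sends a monomial with coefficient [P] to two monomials with
    coefficients proportional to [A * P] and [Q * P], so the product rule holds without commuting
    anything. *)
Lemma op_poly_quad_mult F F' : op_poly_deriv F F' ->
  op_poly_deriv (fun z => quad z * F z)%op (fun z => dquad z * F z + quad z * F' z)%op.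
Proof.
  induction 1 as [k P|F F' G G' _ IHF _ IHG].
  - eapply op_poly_ext; [| |apply (op_poly_plus _ _ _ _
      (op_poly_monomial (k + 1) (A * P)%op)
      (op_poly_monomial (k + 2) ((- c) *: (Q * P))%op))].
    + intros z. unfold quad. rewrite !Cpow_add_r. op_ring.
    + intros z. unfold quad, dquad.
      replace (k + 1 - 1)%nat with k by lia. replace (k + 2 - 1)%nat with (k + 1)%nat by lia.
      rewrite !plus_INR. change (INR 1) with 1. change (INR 2) with (1 + 1).
      rewrite !RtoC_plus. destruct k as [|k].
      * rewrite !Cpow_add_r. change (INR 0) with 0. op_ring.
      * replace (S k - 1)%nat with k by lia. rewrite !Cpow_add_r, !Cpow_S. op_ring.
  - eapply op_poly_ext; [| |apply (op_poly_plus _ _ _ _ IHF IHG)]; intros z; simpl;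
      op_ring.
Qed.

Fixpoint dpow (n : nat) (z : C) : Op :=
  match n with
  | O => zero
  | S n => (dquad z * quad z ^ n + quad z * dpow n z)%op
  end.

Lemma op_poly_pow n : op_poly_deriv (fun z => quad z ^ n)%op (dpow n).
Proof.
  induction n as [|n IH].
  - eapply op_poly_ext; [| |apply (op_poly_monomial 0 one)]; intros z; simpl; op_ring.
  - apply (op_poly_quad_mult _ _ IH).
Qed.

(** Origin of the weight [j]: the derivative of [f^(n+1)] is the sum of [f^i f' f^(n-i)],
    [0 <= i <= n]. When [f'] moves left, exactly the [j] summands with [i > n - j] make the exchange
    that leaves [n - j] factors on its left. *)
Definition comm_sum (n : nat) (z : C) : Op :=
  sum_n_m (fun j => (RtoC (INR j)) *:
    (quad z ^ (n - j) * (A * Q - Q * A) * quad z ^ (j - 1)))%op 1 n.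

Lemma comm_sum_S n z :
  comm_sum (S n) z =
    (quad z * comm_sum n z + (RtoC (INR (S n))) *: ((A * Q - Q * A) * quad z ^ n))%op.
Proof.
  unfold comm_sum. rewrite sum_n_Sm by lia. f_equal.
  - rewrite <- (sum_n_m_mult_l (K := bop_Ring (l2_NormedModule V))).
    apply sum_n_m_ext_loc. intros j Hj. replace (S n - j)%nat with (S (n - j)) by lia.
    simpl pow_n. op_ring.
  - replace (S n - S n)%nat with O by lia. replace (S n - 1)%nat with n by lia.
    simpl pow_n. op_ring.
Qed.

(** The terms in [A * A] and [Q * Q] agree in both orders; the mixed products have coefficients 1
    and 2 in opposite roles, and the difference is a multiple of one commutator. *)
Lemma quad_dquad z :
  (quad z * dquad z)%op = (dquad z * quad z - (z ^ 2 * c) *: (A * Q - Q * A))%op.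
Proof. unfold quad, dquad. op_ring. Qed.

(** Moving every factor [dquad z] to the left of the powers of [quad z] produces
    the commutator terms. *)
Lemma dpow_S n z :
  dpow (S n) z =
    ((RtoC (INR (S n))) *: (dquad z * quad z ^ n) - (z ^ 2 * c) *: comm_sum n z)%op.
Proof.
  induction n as [|n IH].
  - unfold comm_sum. rewrite sum_n_m_zero by lia. simpl. op_ring.
  - change (dpow (S (S n)) z) with (dquad z * quad z ^ (S n) + quad z * dpow (S n) z)%op.
    rewrite IH, comm_sum_S.
    assert (E : (quad z * ((RtoC (INR (S n))) *: (dquad z * quad z ^ n)
       - (z ^ 2 * c) *: comm_sum n z))%op
      = ((RtoC (INR (S n))) *: (quad z * dquad z * quad z ^ n)
         - (z ^ 2 * c) *: (quad z * comm_sum n z))%op) by op_ring.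
    (* The factor [S n] of the induction hypothesis multiplies the new commutator and supplies the
       last summand of [comm_sum (S n)]. *)
    rewrite E, quad_dquad, (S_INR (S n)), RtoC_plus.
    change (quad z ^ S n)%op with (quad z * quad z ^ n)%op. op_ring.
Qed.

End OperatorPolynomials.

(** * Operators of the graph *)

Section CSums.
Variables (A B : Type).

Lemma csum_ext_in (l : list A) (f g : A -> C) :
  (forall a, In a l -> f a = g a) -> csum l f = csum l g.
Proof.
  induction l as [|a l IH]; simpl; intros H; auto. rewrite (H a), IH; auto.
Qed.

Lemma csum_app (l1 l2 : list A) (f : A -> C) :
  csum (l1 ++ l2) f = (csum l1 f + csum l2 f)%C.
Proof. induction l1 as [|a l IH]; simpl; [ring|]; rewrite IH; ring. Qed.

Lemma csum_map (h : A -> B) l (f : B -> C) : csum (map h l) f = csum l (fun a => f (h a)).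
Proof. induction l as [|a l IH]; simpl; auto. rewrite IH; auto. Qed.

Lemma csum_const (l : list A) (k : C) :
  csum l (fun _ => k) = (RtoC (INR (length l)) * k)%C.
Proof.
  induction l as [|a l IH]; [simpl; ring|].
  change (csum (a :: l) (fun _ => k)) with (k + csum l (fun _ => k))%C.
  change (length (a :: l)) with (S (length l)).
  rewrite IH, S_INR, RtoC_plus. ring.
Qed.

Lemma csum_single (l : list A) (a : A) (k : C) : NoDup l -> In a l ->
  csum l (fun a' => if excluded_middle_informative (a' = a) then k else 0%C) = k.
Proof.
  induction 1 as [|b l Hb Hl IH]; simpl; [tauto|].
  destruct (excluded_middle_informative (b = a)) as [->|E]; intros Ha.
  - rewrite (csum_ext_in _ _ (fun _ => 0%C)); [rewrite csum_const; ring|].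
    intros c Hc. destruct (excluded_middle_informative (c = a)) as [->|_]; tauto.
  - rewrite IH; [ring|tauto].
Qed.

End CSums.

Lemma csum_flat_map (A B : Type) (h : A -> list B) l (f : B -> C) :
  csum (flat_map h l) f = csum l (fun a => csum (h a) f).
Proof. induction l as [|a l IH]; simpl; auto. rewrite csum_app, IH; auto. Qed.

Section PathRecursion.
Variable X : bounded_graph.
Notation V := (VX X).
Notation Op := (bop (l2_NormedModule V)).
Variable t : C.

(** Paths are sorted by their first edge [e], because whether the next step backtracks depends on
    this edge and not only on its terminus. *)
Let tail_sum (f : V -> C) (m : nat) (e : EX X) : C :=
  csum (paths m (ter e)) (fun c => (t ^ bc (e :: c) * f (path_ter (ter e) c))%C).

Lemma C_fun_S m (f : V -> C) x : C_fun t (S m) f x = csum (star x) (tail_sum f m).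
Proof.
  unfold C_fun. simpl paths. rewrite csum_flat_map.
  apply csum_ext; intros e. rewrite csum_map. apply csum_ext; intros c. reflexivity.
Qed.

Lemma tail_sum_0 (f : V -> C) e : tail_sum f 0 e = f (ter e).
Proof. unfold tail_sum; simpl. ring. Qed.

(** If every continuation had weight 1, the sum would be [C_fun] at [ter e]; the single continuation
    by [einv e] has weight [t] instead, which costs [1 - t] times its tail sum. *)
Lemma tail_sum_S (f : V -> C) m e :
  tail_sum f (S m) e = (C_fun t (S m) f (ter e) - (1 - t) * tail_sum f m (einv e))%C.
Proof.
  transitivity (csum (star (ter e)) (fun e' => tail_sum f m e' +
    (if excluded_middle_informative (e' = einv e)
     then - (1 - t) * tail_sum f m (einv e) else 0))%C).
  - unfold tail_sum at 1. simpl paths. rewrite csum_flat_map.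
    apply csum_ext; intros e'. rewrite csum_map.
    change (csum (paths m (ter e')) (fun c =>
      (t ^ ((if excluded_middle_informative (e' = einv e) then 1 else 0) + bc (e' :: c))
       * f (path_ter (ter e') c))%C) =
      (tail_sum f m e' + (if excluded_middle_informative (e' = einv e)
        then - (1 - t) * tail_sum f m (einv e) else 0))%C).
    destruct (excluded_middle_informative (e' = einv e)) as [->|_].
    + replace (tail_sum f m (einv e) + - (1 - t) * tail_sum f m (einv e))%C
        with (t * tail_sum f m (einv e))%C by ring.
      unfold tail_sum. rewrite <- csum_scal. apply csum_ext; intros c.
      rewrite Cpow_add_r. simpl (t ^ 1)%C. ring.
    + rewrite Cplus_0_r. reflexivity.
  - rewrite csum_plus, <- C_fun_S, csum_single; [ring|apply star_NoDup|].
    apply In_star, orig_einv.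
Qed.

Lemma C_fun_SS m (f : V -> C) x :
  C_fun t (S (S m)) f x =
    (csum (star x) (fun e => C_fun t (S m) f (ter e))
     - (1 - t) * csum (star x) (fun e => tail_sum f m (einv e)))%C.
Proof.
  rewrite C_fun_S, <- csum_scal.
  rewrite (csum_ext (star x) (f := tail_sum f (S m)) (g := fun e =>
    (C_fun t (S m) f (ter e) + (-1) * ((1 - t) * tail_sum f m (einv e)))%C)).
  - rewrite csum_plus, csum_scal. ring.
  - intros e; rewrite tail_sum_S; ring.
Qed.

Lemma C_op_0 : C_op X t 0 = one.
Proof.
  apply bop_eq; intros f; apply l2_eq; intros x. simpl. unfold C_fun; simpl. ring.
Qed.

Lemma C_op_1 : C_op X t 1 = A_X X.
Proof.
  apply bop_eq; intros f; apply l2_eq; intros x. simpl. rewrite C_fun_S.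
  apply csum_ext; intros e; apply tail_sum_0.
Qed.

(** No edge is left after the reversal, so the correction is a full [D_X]. As
    [D_X = Q_X t + (1 - t)], this differs from the general recursion by [-(1 - t)^2], the source of
    [w] in the resolvent equation. *)
Lemma C_op_2 : C_op X t 2 = (A_X X * A_X X - (1 - t) *: D_X X)%op.
Proof.
  rewrite <- C_op_1 at 2.
  apply bop_eq; intros f; apply l2_eq; intros x.
  change (C_fun t 2 f x = (csum (star x) (fun e => C_fun t 1 f (ter e))
    + - ((1 - t) * (RtoC (INR (deg x)) * f x)))%C).
  rewrite C_fun_SS, (csum_ext_in _ _ (fun e => tail_sum f 0 (einv e)) (fun _ => f x)).
  - rewrite csum_const. unfold deg. ring.
  - intros e He. rewrite tail_sum_0, ter_einv. apply In_star in He. rewrite He; auto.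
Qed.

(** The correction is unfolded once more: reversing the reversed edge restores the sum over first
    edges, again a [C_fun]. Its coefficient [1 - t] turns [D_X] into [Q_X t]. *)
Lemma C_op_SSS m :
  C_op X t (S (S (S m))) =
    (A_X X * C_op X t (S (S m)) - (1 - t) *: (Q_X X t * C_op X t (S m)))%op.
Proof.
  apply bop_eq; intros f; apply l2_eq; intros x.
  change (C_fun t (S (S (S m))) f x =
    (csum (star x) (fun e => C_fun t (S (S m)) f (ter e))
     + - ((1 - t) * (RtoC (INR (deg x)) * C_fun t (S m) f x
                    + - ((1 - t) * C_fun t (S m) f x))))%C).
  rewrite C_fun_SS, (csum_ext_in _ _ (fun e => tail_sum f (S m) (einv e))
    (fun e => (C_fun t (S m) f x + - (1 - t) * tail_sum f m e)%C)).
  - rewrite csum_plus, csum_const, csum_scal, <- C_fun_S. unfold deg. ring.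
  - intros e He. rewrite tail_sum_S, ter_einv, einvK. apply In_star in He. rewrite He.
    ring.
Qed.

(** * Norm bounds and the constant alpha *)

Lemma A_X_norm : bop_norm (A_X X) <= INR (maxdeg X).
Proof.
  pose proof (pos_INR (maxdeg X)) as HM.
  apply bop_norm_le; intros f Hf. apply l2_norm_le; auto. intros s Hs.
  apply Rle_trans with (INR (maxdeg X) ^ 2 * l2_norm f ^ 2).
  - eapply Rle_trans; [|apply (@adj_bound X (fun x => Cmod (f x)) (l2_norm f ^ 2)
      (fun x => Cmod_ge_0 (f x)) (fun s => @sqsum_le_norm V f s) s Hs)].
    apply rsum_le; intros x _. apply pow_incr; split; [apply Cmod_ge_0|].
    apply csum_Cmod.
  - rewrite <- (Rmult_1_r (INR (maxdeg X) ^ 2)) at 2.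
    apply Rmult_le_compat_l; [apply pow2_ge_0|].
    rewrite <- (pow1 2). apply pow_incr; split; [apply l2_norm_ge0|exact Hf].
Qed.

Lemma diagonal_norm (T : Op) (g : V -> C) K :
  0 <= K -> (forall f x, T f x = (g x * f x)%C) -> (forall x, Cmod (g x) <= K) ->
  bop_norm T <= K.
Proof.
  intros HK HT Hg. apply bop_norm_le; intros f Hf. apply l2_norm_le; auto. intros s Hs.
  apply Rle_trans with (K ^ 2 * sqsum f s).
  - unfold sqsum. rewrite <- rsum_scal. apply rsum_le; intros x _.
    rewrite HT, Cmod_mult, Rpow_mult_distr. apply Rmult_le_compat_r; [apply pow2_ge_0|].
    apply pow_incr; split; [apply Cmod_ge_0|auto].
  - rewrite <- (Rmult_1_r (K ^ 2)) at 2. apply Rmult_le_compat_l; [apply pow2_ge_0|].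
    eapply Rle_trans; [apply sqsum_le_norm; auto|].
    rewrite <- (pow1 2). apply pow_incr; split; [apply l2_norm_ge0|exact Hf].
Qed.

Lemma deg_le (x : V) : INR (deg x) <= INR (maxdeg X).
Proof. apply le_INR, maxdeg_ub. Qed.

Lemma D_X_norm : bop_norm (D_X X) <= INR (maxdeg X).
Proof.
  apply (diagonal_norm _ (fun x => RtoC (INR (deg x)))); auto using pos_INR.
  intros x. rewrite Cmod_R, Rabs_pos_eq by apply pos_INR. apply deg_le.
Qed.

Hypothesis Xconn : connected_graph X.
Hypothesis ht : Cmod t < 1.
Hypothesis HM : (1 <= maxdeg X)%nat.

(** A path to a vertex of maximal degree either starts with an edge at [x] or shows that [x] is that
    vertex. *)
Lemma deg_ge1 (x : V) : (1 <= deg x)%nat.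
Proof.
  assert (Hin : forall e : EX X, (1 <= deg (orig e))%nat).
  { intros e. assert (He : In e (star (orig e))) by (apply In_star; auto).
    unfold deg. destruct (star (orig e)); [destruct He|simpl; lia]. }
  destruct (maxdeg_attained X) as [x1 Hx1].
  destruct (Xconn x x1) as ([|e c] & Hc & Hx).
  - simpl in Hx; subst x1. unfold deg; lia.
  - destruct Hc as [<- _]. apply Hin.
Qed.

(** The diagonal entry is [(deg x - 1) + t]; as [deg x >= 1] and [|t| < 1], its modulus is at most
    [deg x]. *)
Lemma Q_X_norm : bop_norm (Q_X X t) <= INR (maxdeg X).
Proof.
  apply (diagonal_norm _ (fun x => RtoC (INR (deg x)) - (1 - t))%C); auto using pos_INR.
  - intros f x. change (RtoC (INR (deg x)) * f x + - ((1 - t) * f x) =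
      (RtoC (INR (deg x)) - (1 - t)) * f x)%C. ring.
  - intros x. replace (RtoC (INR (deg x)) - (1 - t))%C with (RtoC (INR (deg x) - 1) + t)%C
      by (rewrite RtoC_minus; ring).
    assert (H1 := le_INR _ _ (deg_ge1 x)). change (INR 1) with 1 in H1.
    eapply Rle_trans; [apply Cmod_triangle|].
    rewrite Cmod_R, Rabs_pos_eq by lra. pose proof (deg_le x). lra.
Qed.

Lemma Cmod_1_minus : Cmod (1 - t) <= 1 + Cmod t.
Proof.
  eapply Rle_trans; [apply Cmod_triangle|]. rewrite Cmod_opp, Cmod_1. lra.
Qed.

Lemma alpha_eq :
  alpha X t ^ 2 = INR (maxdeg X) * alpha X t + (1 + Cmod t) * INR (maxdeg X).
Proof.
  unfold alpha. pose proof (pos_INR (maxdeg X)). pose proof (Cmod_ge_0 t).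
  set (s := sqrt _).
  assert (Hs : s ^ 2 = INR (maxdeg X) ^ 2 + 4 * (Cmod t + 1) * INR (maxdeg X))
    by (apply pow2_sqrt; nra).
  replace (((INR (maxdeg X) + s) / 2) ^ 2)
    with ((INR (maxdeg X) ^ 2 + 2 * INR (maxdeg X) * s + s ^ 2) / 4) by field.
  rewrite Hs. field.
Qed.

Lemma maxdeg_ge1 : 1 <= INR (maxdeg X).
Proof. apply (le_INR 1). auto. Qed.

Lemma alpha_gt0 : 0 < alpha X t.
Proof.
  pose proof maxdeg_ge1. unfold alpha.
  match goal with |- context [sqrt ?y] => pose proof (sqrt_pos y) end. lra.
Qed.

(** If [alpha < 1 + |t|], then [alpha^2 < 2 alpha < alpha + 1 + |t|], while [alpha_eq] with [M >= 1]
    gives the opposite inequality. This absorbs powers of [1 - t] into powers of [alpha]. *)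
Lemma alpha_ge : 1 + Cmod t <= alpha X t.
Proof.
  pose proof alpha_eq. pose proof maxdeg_ge1. pose proof alpha_gt0.
  pose proof (Cmod_ge_0 t). apply Rnot_lt_le; intros Hlt.
  assert (alpha X t + (1 + Cmod t) <= alpha X t ^ 2) by nra. nra.
Qed.

Lemma Q_X_scal_norm : bop_norm ((1 - t) *: Q_X X t)%op <= (1 + Cmod t) * INR (maxdeg X).
Proof.
  eapply Rle_trans; [apply bop_norm_scal|].
  apply Rmult_le_compat; auto using Cmod_ge_0, bop_norm_ge0, Q_X_norm, Cmod_1_minus.
Qed.

Lemma bop_norm_minus (T S : Op) : bop_norm (T - S)%op <= bop_norm T + bop_norm S.
Proof.
  eapply Rle_trans; [apply bop_norm_triangle|].
  apply Rplus_le_compat_l.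
  apply (Req_le (bop_norm (opp S))),
    (@norm_opp C_AbsRing (bop_NormedModule (l2_NormedModule V))).
Qed.

Lemma C_op_norm m : bop_norm (C_op X t m) <= alpha X t ^ m.
Proof.
  pose proof alpha_eq as Ha. pose proof alpha_gt0 as Ha0. pose proof maxdeg_ge1 as H1.
  pose proof (Cmod_ge_0 t) as Ht0.
  assert (HMa : INR (maxdeg X) <= alpha X t) by nra.
  (* The recursion reaches back two indices and is valid from index 3 on, so three consecutive
     bounds are carried along. *)
  enough (H : bop_norm (C_op X t m) <= alpha X t ^ m /\
    bop_norm (C_op X t (S m)) <= alpha X t ^ S m /\
    bop_norm (C_op X t (S (S m))) <= alpha X t ^ S (S m)) by apply H.
  induction m as [|m (IH0 & IH1 & IH2)].
  - rewrite C_op_0, C_op_1, C_op_2. split; [|split].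
    + apply (bop_norm_pow (one : Op) 0 (alpha X t)).
      apply bop_norm_le. intros x Hx. simpl. eapply Rle_trans; [exact Hx|].
      pose proof alpha_ge; lra.
    + rewrite pow_1. eapply Rle_trans; [apply A_X_norm|]. auto.
    + rewrite Ha. eapply Rle_trans; [apply bop_norm_minus|]. apply Rplus_le_compat.
      * eapply Rle_trans; [apply bop_norm_mult|]. pose proof A_X_norm.
        pose proof (bop_norm_ge0 (A_X X)). apply Rmult_le_compat; lra.
      * eapply Rle_trans; [apply bop_norm_scal|].
        apply Rmult_le_compat; auto using Cmod_ge_0, bop_norm_ge0, D_X_norm, Cmod_1_minus.
  - split; [auto|split; [auto|]]. rewrite C_op_SSS.
    assert (E : ((1 - t) *: (Q_X X t * C_op X t (S m)))%op
      = (((1 - t) *: Q_X X t) * C_op X t (S m))%op) by op_ring.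
    rewrite E. eapply Rle_trans; [apply bop_norm_minus|].
    replace (alpha X t ^ S (S (S m))) with (INR (maxdeg X) * alpha X t ^ S (S m)
      + (1 + Cmod t) * INR (maxdeg X) * alpha X t ^ S m).
    2: { change (alpha X t ^ S (S m)) with (alpha X t * alpha X t ^ S m).
         change (alpha X t ^ S (S (S m))) with (alpha X t * (alpha X t * alpha X t ^ S m)).
         transitivity ((INR (maxdeg X) * alpha X t + (1 + Cmod t) * INR (maxdeg X))
           * alpha X t ^ S m); [ring|]. rewrite <- Ha. ring. }
    apply Rplus_le_compat; (eapply Rle_trans; [apply bop_norm_mult|]);
      apply Rmult_le_compat; auto using bop_norm_ge0, A_X_norm, Q_X_scal_norm.
Qed.

Section Radius.
Variable r : R.
Hypothesis Hr : 0 <= r.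
Hypothesis Har : alpha X t * r < 1.

Definition f_bound : R := INR (maxdeg X) * r + (1 + Cmod t) * INR (maxdeg X) * r ^ 2.

Lemma f_bound_ge0 : 0 <= f_bound.
Proof.
  unfold f_bound. pose proof maxdeg_ge1. pose proof (Cmod_ge_0 t).
  apply Rplus_le_le_0_compat; repeat apply Rmult_le_pos; lra.
Qed.

(** After multiplication by [alpha^2] the two terms contain [alpha r] and [(alpha r)^2]; replacing
    these by 1 gives the right side of [alpha_eq]. *)
Lemma f_bound_lt1 : f_bound < 1.
Proof.
  pose proof alpha_eq as Ha. pose proof alpha_gt0 as Ha0. pose proof maxdeg_ge1.
  pose proof (Cmod_ge_0 t).
  apply (Rmult_lt_reg_l (alpha X t ^ 2)); [apply pow_lt; auto|].
  replace (alpha X t ^ 2 * f_bound) with (INR (maxdeg X) * alpha X t * (alpha X t * r)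
    + (1 + Cmod t) * INR (maxdeg X) * (alpha X t * r) ^ 2) by (unfold f_bound; ring).
  rewrite Rmult_1_r, Ha at 1.
  assert (0 <= alpha X t * r) by (apply Rmult_le_pos; lra).
  assert ((alpha X t * r) ^ 2 <= 1) by nra.
  assert (0 < INR (maxdeg X) * alpha X t) by nra.
  assert (0 < (1 + Cmod t) * INR (maxdeg X)) by nra.
  nra.
Qed.

Lemma f_X_norm z : Cmod z <= r -> bop_norm (f_X X t z) <= f_bound.
Proof.
  intros Hz. unfold f_X, f_bound. pose proof (Cmod_ge_0 z).
  assert (E : ((z ^ 2 * (1 - t)) *: Q_X X t)%op = ((z ^ 2) *: ((1 - t) *: Q_X X t))%op)
    by op_ring.
  rewrite E. eapply Rle_trans; [apply bop_norm_minus|].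
  rewrite (Rmult_comm _ r), (Rmult_comm _ (r ^ 2)).
  apply Rplus_le_compat; (eapply Rle_trans; [apply bop_norm_scal|]).
  - apply Rmult_le_compat; auto using bop_norm_ge0, A_X_norm.
  - apply Rmult_le_compat; auto using bop_norm_ge0, Q_X_scal_norm, Cmod_ge_0.
    rewrite Cmod_Cpow. apply pow_incr; auto.
Qed.

Lemma one_minus_radius z : Cmod z <= r -> Cmod ((1 - t) ^ 2 * z ^ 2) < 1.
Proof.
  intros Hz. pose proof alpha_ge. pose proof Cmod_1_minus. pose proof alpha_gt0.
  pose proof (Cmod_ge_0 z). pose proof (Cmod_ge_0 (1 - t)).
  rewrite Cmod_mult, !Cmod_Cpow, <- Rpow_mult_distr.
  assert (Cmod (1 - t) * Cmod z <= alpha X t * r) by (apply Rmult_le_compat; lra).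
  assert (0 <= Cmod (1 - t) * Cmod z) by (apply Rmult_le_pos; auto). nra.
Qed.

End Radius.
End PathRecursion.

(** * Resolvent and path generating function *)

(** [(n+1)^2] is at most [(n+1)(n+2)], the coefficient in the second derivative of the geometric
    series. *)
Lemma ex_series_square_geom (q : R) : 0 <= q < 1 ->
  ex_series (fun n => (INR n + 1) ^ 2 * q ^ n).
Proof.
  intros Hq.
  assert (HCV : CV_radius (fun _ => 1) = Finite 1).
  { rewrite <- Rinv_1. apply CV_radius_finite_DAlembert; [intros; lra|lra|].
    apply (is_lim_seq_ext (fun _ => 1)); [|apply is_lim_seq_const].
    intros n. rewrite Rabs_pos_eq; lra. }
  assert (H : ex_series (fun n =>
    Rabs (PS_derive (PS_derive (fun _ => 1)) n * q ^ n))).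
  { apply CV_disk_inside. rewrite !CV_radius_derive, HCV. simpl.
    rewrite Rabs_pos_eq; lra. }
  apply (@ex_series_le R_AbsRing R_CompleteNormedModule _ _) with (2 := H).
  intros n. change (Rabs ((INR n + 1) ^ 2 * q ^ n)
    <= Rabs (PS_derive (PS_derive (fun _ => 1)) n * q ^ n)).
  rewrite !Rabs_mult. apply Rmult_le_compat_r; [apply Rabs_pos|].
  unfold PS_derive. rewrite !S_INR. pose proof (pos_INR n).
  rewrite !Rabs_pos_eq; nra.
Qed.

Lemma is_series_C_first (k : C) : (fun n => match n with O => k | S _ => RtoC 0 end) ~~> k.
Proof.
  apply is_series_norm. intros eps He. exists O. intros n _.
  replace (sum_n _ n) with k; [rewrite (@norm_minus_self C_AbsRing C_NormedModule); auto|].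
  induction n as [|n IH]; [rewrite sum_O; auto|].
  rewrite sum_Sn, <- IH. symmetry. apply Cplus_0_r.
Qed.

Lemma is_series_C_csum (A : Type) (l : list A) (a : A -> nat -> C) (s : A -> C) :
  (forall e, a e ~~> s e) -> (fun n => csum l (fun e => a e n)) ~~> csum l s.
Proof.
  intros H. induction l as [|e l IH]; simpl.
  - eapply is_series_C_ext; [|apply (is_series_C_first 0)]. intros [|n]; auto.
  - apply is_series_C_plus; auto.
Qed.

(** Index [k] stands for the coefficient of [z^(k+1)]; shifting by two turns the recursion into a
    linear equation for the generating function, with [c] and [h] as inhomogeneity. *)
Lemma two_step_series (a h : nat -> C) (s c z tau eta : C) :
  a 0%nat = 0%C -> a 1%nat = c ->
  (forall k, a (S (S k)) = s ^ 2 * a k + s * h k)%C ->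
  (fun k => a k * z ^ (S k))%C ~~> tau ->
  (fun k => h k * z ^ (S k))%C ~~> eta ->
  (tau = c * z ^ 2 + (s ^ 2 * z ^ 2 * tau + s * z ^ 2 * eta))%C.
Proof.
  intros H0 H1 H2 Ha Hh.
  apply (is_series_inj (V := C_NormedModule) _ _ _ Ha).
  assert (Hsh := is_series_C_shift _ _ (is_series_C_shift _ _
    (is_series_C_plus _ _ _ _ (is_series_C_scal (s ^ 2 * z ^ 2) _ _ Ha)
       (is_series_C_scal (s * z ^ 2) _ _ Hh)))).
  eapply is_series_C_ext; [|apply (is_series_C_plus _ _ _ _
    (is_series_C_shift _ _ (is_series_C_first (c * z ^ 2))) Hsh)].
  intros [|[|k]]; simpl.
  - rewrite H0. ring.
  - rewrite H1. ring.
  - rewrite H2. ring.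
Qed.

Section Resolvent.
Variables (X : bounded_graph) (t : C) (x0 x : VX X) (r : R).
Notation V := (VX X).
Notation Op := (bop (l2_NormedModule V)).
Hypothesis Xconn : connected_graph X.
Hypothesis ht : Cmod t < 1.
Hypothesis HM : (1 <= maxdeg X)%nat.
Hypothesis Hr : 0 <= r.
Hypothesis Har : alpha X t * r < 1.

Notation f := (quad V (A_X X) (Q_X X t) (1 - t)).
Notation f' := (dquad V (A_X X) (Q_X X t) (1 - t)).
Notation al := (alpha X t).
Notation phi := (f_bound X t r).
Notation v := (delta x0).
Notation kap := (kronecker x0 x).
Notation d := (RtoC (INR (deg x))).
Notation g := (fun m => entry (C_op X t m) x0 x).
Notation w z := ((1 - t) ^ 2 * z ^ 2)%C.

Lemma delta_norm : l2_norm v <= 1.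
Proof. apply l2_norm_le; [lra|]. apply kronecker_bound. Qed.

Lemma entry_le (T : Op) y : Cmod (entry T x0 y) <= bop_norm T.
Proof.
  eapply Rle_trans; [apply bop_apply_le|]. rewrite <- (Rmult_1_r (bop_norm T)) at 2.
  apply Rmult_le_compat_l; [apply bop_norm_ge0|apply delta_norm].
Qed.

Lemma one_minus_w_neq0 z : Cmod z <= r -> (1 - w z)%C <> 0%C.
Proof.
  intros Hz E.
  assert (H : Cmod (w z) < 1) by (apply (one_minus_radius X t ht HM r Har); auto).
  replace (w z) with (1 - (1 - w z))%C in H by ring. rewrite E in H.
  replace (1 - 0)%C with (RtoC 1) in H by ring. rewrite Cmod_1 in H. lra.
Qed.

(** [A_X] and [Q_X] act on finitely many values at a time, so the equation can be verified at each
    vertex by comparing coefficients of powers of [z]. *)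
Lemma C_series_resolvent z : Cmod z <= r ->
  exists gam : l2 V,
    (forall y, (fun m => entry (C_op X t m) x0 y * z ^ m)%C ~~> gam y) /\
    gam = plus (f z gam) (scal (1 - w z)%C v).
Proof.
  intros Hz. pose proof (alpha_gt0 X t HM) as Ha0. pose proof (Cmod_ge_0 z).
  destruct (Series.ex_series_geom (al * r)) as [B HB].
  { rewrite Rabs_pos_eq; auto. apply Rmult_le_pos; lra. }
  destruct (ex_series_op V (fun m => (z ^ m) *: C_op X t m)%op (fun m => (al * r) ^ m) B)
    as [G HG].
  { intros m. eapply Rle_trans; [apply bop_norm_scal|].
    rewrite Cmod_Cpow, Rpow_mult_distr, Rmult_comm.
    apply Rmult_le_compat; auto using Cmod_ge_0, bop_norm_ge0, C_op_norm, pow_le.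
    apply pow_incr; auto. }
  { exact HB. }
  exists (G v).
  assert (Hg : forall y, (fun m => entry (C_op X t m) x0 y * z ^ m)%C ~~> G v y).
  { intros y. eapply is_series_C_ext; [|apply (is_series_apply V _ _ v y HG)].
    intros m. cbv beta. rewrite bop_scalE, l2_scalE. apply Cmult_comm. }
  split; auto. apply l2_eq; intros y.
  apply (is_series_inj (V := C_NormedModule) _ _ _ (Hg y)).
  assert (HA := is_series_C_csum _ (star y) _ (fun e => G v (ter e))
    (fun e => Hg (ter e))).
  assert (HQ := is_series_C_scal (RtoC (INR (deg y)) - (1 - t)) _ _ (Hg y)).
  assert (HA' := is_series_C_shift _ _ (is_series_C_scal z _ _ HA)).
  assert (HQ' := is_series_C_shift _ _ (is_series_C_shift _ _
    (is_series_C_scal (- (z ^ 2 * (1 - t))) _ _ HQ))).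
  assert (Hk := is_series_C_first (kronecker x0 y)).
  assert (Hk' := is_series_C_shift _ _ (is_series_C_shift _ _
    (is_series_C_first (- w z * kronecker x0 y)))).
  assert (Hall := is_series_C_plus _ _ _ _ (is_series_C_plus _ _ _ _ HA' HQ')
    (is_series_C_plus _ _ _ _ Hk Hk')).
  match type of Hall with _ ~~> ?l =>
    replace ((plus (f z (G v)) (scal (1 - w z)%C v) : l2 V) y) with l end.
  2: { unfold quad. op_expand. op_values.
       change (A_X X (G v) y) with (csum (star y) (fun e => G v (ter e))).
       change (Q_X X t (G v) y)
         with (RtoC (INR (deg y)) * G v y + - ((1 - t) * G v y))%C.
       change (v y) with (kronecker x0 y). ring. }
  eapply is_series_C_ext; [|apply Hall].
  assert (Hcs : forall m, csum (star y) (fun e => entry (C_op X t m) x0 (ter e) * z ^ m)%C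
    = (z ^ m * entry (A_X X * C_op X t m)%op x0 y)%C).
  { intros m. unfold entry. rewrite bop_multE.
    change (A_X X (C_op X t m v) y) with (csum (star y) (fun e => C_op X t m v (ter e))).
    rewrite <- csum_scal. apply csum_ext; intros; ring. }
  (* [m = 0] accounts for the 1 and [m = 2] for the [- w z] in the factor [1 - w z]. *)
  intros m. cbv beta. destruct m as [|[|[|m]]].
  - rewrite C_op_0. change (entry one x0 y) with (kronecker x0 y). simpl. ring.
  - rewrite Hcs, C_op_0, C_op_1. unfold entry. op_expand. simpl. ring.
  - rewrite Hcs, C_op_0, C_op_1, C_op_2. unfold entry. op_expand. op_values.
    change (D_X X v y) with (RtoC (INR (deg y)) * v y)%C.
    change (v y) with (kronecker x0 y). simpl. ring.
  - rewrite Hcs, C_op_SSS. unfold entry. op_expand. op_values.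
    change (Q_X X t (C_op X t (S m) v) y)
      with (RtoC (INR (deg y)) * C_op X t (S m) v y + - ((1 - t) * C_op X t (S m) v y))%C.
    rewrite !Cpow_S. ring.
Qed.

Lemma f_norm z : Cmod z <= r -> bop_norm (f z) <= phi.
Proof. intros Hz. apply (f_X_norm X t Xconn ht HM r z Hz). Qed.

Lemma f'_norm z : Cmod z <= r ->
  bop_norm (f' z) <= INR (maxdeg X) + 2 * r * (2 * INR (maxdeg X)).
Proof.
  intros Hz. pose proof (Cmod_ge_0 z). unfold dquad.
  eapply Rle_trans; [apply bop_norm_minus|]. apply Rplus_le_compat; [apply A_X_norm|].
  replace ((2 * z * (1 - t)) *: Q_X X t)%op with ((2 * z) *: ((1 - t) *: Q_X X t))%op
    by op_ring.
  eapply Rle_trans; [apply bop_norm_scal|].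
  rewrite Cmod_mult, Cmod_R, Rabs_pos_eq by lra.
  pose proof (maxdeg_ge1 X HM).
  apply Rmult_le_compat; [apply Rmult_le_pos; lra|apply bop_norm_ge0|lra|].
  eapply Rle_trans; [apply Q_X_scal_norm; auto|]. apply Rmult_le_compat_r; lra.
Qed.

Definition psi_term (z : C) (k : nat) : C := (f' z * f z ^ k)%op v x.

Lemma psi_term_le z k : Cmod z <= r ->
  Cmod (psi_term z k) <= (INR (maxdeg X) + 2 * r * (2 * INR (maxdeg X))) * phi ^ k.
Proof.
  intros Hz. eapply Rle_trans; [apply entry_le|].
  eapply Rle_trans; [apply bop_norm_mult|].
  apply Rmult_le_compat; auto using bop_norm_ge0, f'_norm.
  apply bop_norm_pow, f_norm; auto.
Qed.

(** [z f'(z) (1 - f(z))^-1] in terms of the generating function of the [C_m(t)]. *)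
Lemma psi_series z : Cmod z <= r ->
  exists gam psi : C,
    (fun m => g m * z ^ m)%C ~~> gam /\ psi_term z ~~> psi /\
    (z * psi * (1 - w z) = gam * (1 - z ^ 2 * (1 - t) * (d - (1 - t))) - (1 - w z) * kap)%C.
Proof.
  intros Hz. destruct (C_series_resolvent z Hz) as (gam & Hgam & E).
  assert (Hw := one_minus_w_neq0 z Hz).
  exists (gam x), (f' z gam x / (1 - w z))%C. split; [apply Hgam|split].
  (* Iterating the equation for [gam] telescopes: the partial sums of [psi_term] miss their limit by
     a multiple of [f' f^(n+1) gam], which decays like [phi^(n+1)]. *)
  - assert (Hstep : forall n, (f z ^ n)%op gam
      = plus ((f z ^ S n)%op gam) (scal (1 - w z)%C ((f z ^ n)%op v))).
    { induction n as [|n IH].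
      - exact E.
      - change (f z ((f z ^ n)%op gam) = plus (f z ((f z ^ S n)%op gam))
          (scal (1 - w z)%C (f z ((f z ^ n)%op v)))).
        rewrite IH at 1. rewrite bop_linear_plus, bop_linear_scal. auto. }
    assert (Hsum : forall n, f' z gam x = (f' z ((f z ^ S n)%op gam) x
      + (1 - w z) * sum_n (psi_term z) n)%C).
    { induction n as [|n IH].
      - rewrite sum_O. change gam with ((f z ^ 0)%op gam) at 1. rewrite (Hstep 0%nat).
        rewrite bop_linear_plus, bop_linear_scal. reflexivity.
      - rewrite IH, (Hstep (S n)), bop_linear_plus, bop_linear_scal, sum_Sn.
        op_values. change (plus (sum_n (psi_term z) n) (psi_term z (S n)))
          with (sum_n (psi_term z) n + psi_term z (S n))%C.
        change (psi_term z (S n)) with (f' z ((f z ^ S n)%op v) x). ring. }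
    assert (Halg : forall a b c e : C, c <> 0%C -> b = (a + c * e)%C ->
      (e - b / c = - (a / c))%C) by (intros; subst; field; auto).
    apply is_series_norm. intros eps He.
    set (K := INR (maxdeg X) + 2 * r * (2 * INR (maxdeg X))).
    assert (HK : 0 <= K).
    { eapply Rle_trans; [apply bop_norm_ge0|apply (f'_norm z Hz)]. }
    assert (Hphi := f_bound_lt1 X t HM r Hr Har).
    assert (Hphi0 := f_bound_ge0 X t HM r Hr).
    pose (L := K * l2_norm gam / Cmod (1 - w z)).
    assert (Hcw : 0 < Cmod (1 - w z)) by (apply Cmod_gt_0; auto).
    assert (HL : 0 <= L).
    { apply Rdiv_le_0_compat; auto. apply Rmult_le_pos; auto using l2_norm_ge0. }
    destruct (pow_lt_1_zero phi) with (y := eps / (L + 1)) as [N HN].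
    { rewrite Rabs_pos_eq; auto. }
    { apply Rdiv_lt_0_compat; lra. }
    exists N. intros n Hn.
    change (Cmod (sum_n (psi_term z) n - f' z gam x / (1 - w z))%C < eps).
    rewrite (Halg _ _ _ _ Hw (Hsum n)).
    rewrite Cmod_opp, Cmod_div by auto.
    specialize (HN (S n) (le_S _ _ Hn)). rewrite Rabs_pos_eq in HN by (apply pow_le; auto).
    apply Rle_lt_trans with (L * phi ^ S n).
    + unfold L, Rdiv. rewrite Rmult_assoc, (Rmult_comm (/ _)), <- Rmult_assoc.
      apply Rmult_le_compat_r; [left; apply Rinv_0_lt_compat; auto|].
      eapply Rle_trans; [apply bop_apply_le|]. rewrite (Rmult_assoc K).
      apply Rmult_le_compat; auto using bop_norm_ge0, l2_norm_ge0, f'_norm.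
      rewrite Rmult_comm.
      eapply Rle_trans; [apply (norm_bop_le (f z ^ S n)%op (gam : l2_NormedModule V))|].
      apply Rmult_le_compat_r; [apply l2_norm_ge0|]. apply bop_norm_pow, f_norm; auto.
    + apply Rle_lt_trans with (L * (eps / (L + 1))).
      * apply Rmult_le_compat_l; lra.
      * apply Rlt_le_trans with ((L + 1) * (eps / (L + 1))).
        -- apply Rmult_lt_compat_r; [apply Rdiv_lt_0_compat|]; lra.
        -- right; field; lra.
  (* The equation at [x] eliminates [A_X X gam x]; what remains is diagonal and involves only
     [gam x]. *)
  - assert (Ex : gam x = (z * A_X X gam x + - (z ^ 2 * (1 - t) * Q_X X t gam x)
        + (1 - w z) * kap)%C).
    { transitivity ((plus (f z gam) (scal (1 - w z)%C v) : l2 V) x);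
        [rewrite <- E; auto|]. unfold quad. op_expand. op_values. reflexivity. }
    assert (EQ : Q_X X t gam x = ((d - (1 - t)) * gam x)%C).
    { change (Q_X X t gam x) with (d * gam x + - ((1 - t) * gam x))%C. ring. }
    assert (EA : (z * A_X X gam x)%C = (gam x + z ^ 2 * (1 - t) * ((d - (1 - t)) * gam x)
       - (1 - w z) * kap)%C).
    { rewrite <- EQ. rewrite Ex at 1. ring. }
    assert (Halg : forall a b c : C, c <> 0%C -> (a * (b / c) * c = a * b)%C)
      by (intros; field; auto).
    rewrite (Halg _ _ _ Hw).
    unfold dquad. op_expand. op_values.
    transitivity (z * A_X X gam x - 2 * z ^ 2 * (1 - t) * Q_X X t gam x)%C; [ring|].
    rewrite EA, EQ. ring.
Qed.

End Resolvent.

(** * Coefficients without the remainder term *)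

Section Coefficients.
Variables (X : bounded_graph) (t : C) (x0 x : VX X).
Notation V := (VX X).
Notation Op := (bop (l2_NormedModule V)).
Notation al := (alpha X t).
Notation v := (delta x0).
Notation kap := (kronecker x0 x).
Notation d := (RtoC (INR (deg x))).
Notation g := (fun m => entry (C_op X t m) x0 x).
Notation w z := ((1 - t) ^ 2 * z ^ 2)%C.

Definition back_sum (m : nat) : C :=
  sum_n_m (fun j => ((1 - t) ^ (2 * j - 1) * g (m - 2 * j)%nat)%C) 1 (jmax m).

Definition even_power (m : nat) : C := if Nat.even m then ((1 - t) ^ (m - 1))%C else 0%C.

(** The formula for the entries of [C^cbc_m(t)] without the term [R_m(t)], taken
    as the definition for all [m >= 1]. *)
Definition S_coef (m : nat) : C :=
  (g m - (d - 2 * (1 - t)) * back_sum m - t * (d * kap) * even_power m)%C.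

(** The shift is stated from index 1 on: [jmax 0] and [jmax 2] are both 0 by truncated
    subtraction. *)
Lemma jmax_SSS m : jmax (S (S (S m))) = S (jmax (S m)).
Proof.
  unfold jmax. replace (S (S (S m)) + 1)%nat with (S m + 1 + 1 * 2)%nat by lia.
  rewrite Nat.div_add by lia.
  assert (1 <= (S m + 1) / 2)%nat by (apply Nat.div_le_lower_bound; lia). lia.
Qed.

(** The summand [j = 1] is the inhomogeneity; reindexing the others by [j + 1] costs a factor
    [(1 - t)^2]. *)
Lemma back_sum_SSS m :
  back_sum (S (S (S m))) = ((1 - t) ^ 2 * back_sum (S m) + (1 - t) * g (S m))%C.
Proof.
  unfold back_sum. rewrite jmax_SSS, sum_Sn_m by lia.
  match goal with |- _ = (?a + ?b)%C => rewrite (Cplus_comm a b) end.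
  apply (f_equal2 Cplus).
  - replace (2 * 1 - 1)%nat with 1%nat by lia.
    replace (S (S (S m)) - 2 * 1)%nat with (S m) by lia. simpl. ring.
  - rewrite <- (sum_n_m_mult_l (K := C_Ring)), <- sum_n_m_S.
    apply sum_n_m_ext_loc. intros j Hj.
    replace (S (S (S m)) - 2 * S j)%nat with (S m - 2 * j)%nat by lia.
    replace (2 * S j - 1)%nat with (2 + (2 * j - 1))%nat by lia.
    rewrite Cpow_add_r. change mult with Cmult. C_ring.
Qed.

Lemma even_power_SSS m : even_power (S (S (S m))) = ((1 - t) ^ 2 * even_power (S m))%C.
Proof.
  unfold even_power. change (Nat.even (S (S (S m)))) with (Nat.even (S m)).
  destruct (Nat.even (S m)); [|ring].
  replace (S (S (S m)) - 1)%nat with (2 + (S m - 1))%nat by lia. apply Cpow_add_r.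
Qed.

Lemma D_X_apply (h : l2 V) : D_X X h x = (d * h x)%C.
Proof. reflexivity. Qed.

Lemma entry_Ccbc_1 : entry (Ccbc X t 1) x0 x = S_coef 1.
Proof.
  unfold S_coef, back_sum, even_power. rewrite sum_n_m_zero by (unfold jmax; simpl; lia).
  simpl. change (zero : C) with (RtoC 0). unfold entry. ring.
Qed.

(** At [m = 2] the definition of [Ccbc] departs from the general pattern; the defect is the source
    of the exponential containing [t D - C_2]. *)
Lemma entry_Ccbc_2 :
  entry (Ccbc X t 2) x0 x =
    (S_coef 2 + entry (t *: D_X X - C_op X t 2)%op x0 x * (1 - t))%C.
Proof.
  unfold S_coef, back_sum, even_power. rewrite sum_n_m_zero by (unfold jmax; simpl; lia).
  change (zero : C) with (RtoC 0). unfold Ccbc, entry. op_expand. op_values.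
  change (D_X X v x) with (d * kap)%C. simpl (Nat.even 2). cbv iota.
  replace (2 - 1)%nat with 1%nat by lia. simpl ((1 - t) ^ 1)%C. ring.
Qed.

Lemma entry_Ccbc_SSS k :
  entry (Ccbc X t (S (S (S k)))) x0 x =
    (S_coef (S (S (S k))) + (1 - t) * entry (R_op X t (S (S (S k)))) x0 x)%C.
Proof.
  unfold S_coef, Ccbc, entry. repeat (progress op_expand). repeat (progress op_values).
  change (I_X X) with (one : Op). rewrite ?bop_oneE.
  rewrite !D_X_apply. change (v x) with kap.
  match goal with |- context [sum_n_m ?a 1 ?m] =>
    replace ((sum_n_m a 1 m : Op) v x) with (back_sum (S (S (S k)))) end.
  - unfold even_power. destruct (Nat.even (S (S (S k)))); ring.
  - symmetry. etransitivity; [apply sum_n_m_apply|]. apply sum_n_m_ext. intros j.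
    op_expand. op_values. reflexivity.
Qed.

Lemma entry_R_op m : entry (R_op X t m) x0 x = (R_fun t m x * kap)%C.
Proof. reflexivity. Qed.

Lemma sum_n_m_C_le (a : nat -> C) n m K : 0 <= K -> (1 <= n)%nat ->
  (forall i, (n <= i <= m)%nat -> Cmod (a i) <= K) ->
  Cmod (sum_n_m a n m) <= INR m * K.
Proof.
  intros HK Hn Ha. destruct (Nat.le_gt_cases n m) as [H|H].
  - induction H as [|m H IH].
    + rewrite sum_n_n. apply Rle_trans with (1 * K); [rewrite Rmult_1_l; apply Ha; lia|].
      apply Rmult_le_compat_r; auto. apply (le_INR 1); lia.
    + rewrite sum_n_Sm by lia. eapply Rle_trans; [apply Cmod_triangle|].
      rewrite S_INR, Rmult_plus_distr_r, Rmult_1_l. apply Rplus_le_compat.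
      * apply IH. intros i Hi. apply Ha; lia.
      * apply Ha; lia.
  - rewrite sum_n_m_zero by auto.
    change (Cmod 0 <= INR m * K). rewrite Cmod_0. apply Rmult_le_pos; auto using pos_INR.
Qed.

Lemma jmax_le m : (2 * jmax (S m) <= m)%nat.
Proof.
  unfold jmax. pose proof (Nat.Div0.mul_div_le (S m + 1) 2). lia.
Qed.

Lemma linear_le_quadratic k : 1 <= (INR k + 1) /\ INR k + 1 <= (INR k + 1) ^ 2.
Proof. pose proof (pos_INR k). split; nra. Qed.

Variable r : R.
Hypothesis Xconn : connected_graph X.
Hypothesis ht : Cmod t < 1.
Hypothesis HM : (1 <= maxdeg X)%nat.
Hypothesis Hr : 0 <= r.
Hypothesis Har : alpha X t * r < 1.

Lemma g_le m : Cmod (g m) <= al ^ m.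
Proof.
  eapply Rle_trans; [apply entry_le|]. apply C_op_norm; auto.
Qed.

Lemma Cmod_1_minus_le : Cmod (1 - t) <= al.
Proof.
  eapply Rle_trans; [apply Cmod_1_minus; auto|]. apply alpha_ge; auto.
Qed.

Lemma alpha_ge1 : 1 <= al.
Proof. pose proof (alpha_ge X t ht HM). pose proof (Cmod_ge_0 t). lra. Qed.

Lemma even_power_le m : Cmod (even_power (S m)) <= al ^ S m.
Proof.
  pose proof alpha_ge1 as H1. unfold even_power. destruct (Nat.even (S m)).
  - replace (S m - 1)%nat with m by lia. rewrite Cmod_Cpow.
    apply Rle_trans with (al ^ m).
    + apply pow_incr; split; [apply Cmod_ge_0|apply Cmod_1_minus_le].
    + apply Rle_pow; auto.
  - rewrite Cmod_0. apply pow_le; lra.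
Qed.

Lemma back_sum_le m : Cmod (back_sum (S m)) <= (INR m + 1) * al ^ S m.
Proof.
  pose proof alpha_ge1 as H1. pose proof Cmod_1_minus_le as H2.
  enough (H : Cmod (back_sum (S m)) <= (INR m + 1) * al ^ S m /\
    Cmod (back_sum (S (S m))) <= (INR (S m) + 1) * al ^ S (S m)) by apply H.
  induction m as [|m [IH1 IH2]].
  - assert (H0 : forall m, jmax m = O -> Cmod (back_sum m) = 0).
    { intros m Hm. unfold back_sum. rewrite Hm, sum_n_m_zero by lia. apply Cmod_0. }
    rewrite !H0 by reflexivity. split; simpl INR; apply Rmult_le_pos; try lra;
      apply pow_le; lra.
  - split; auto. rewrite back_sum_SSS.
    eapply Rle_trans; [apply Cmod_triangle|]. rewrite !Cmod_mult, Cmod_Cpow.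
    replace ((INR (S (S m)) + 1) * al ^ S (S (S m)))
      with (al ^ 2 * ((INR m + 1) * al ^ S m) + 2 * al * (al * al ^ S m))
      by (rewrite !S_INR; simpl; ring).
    assert (Hp : 0 <= al ^ S m) by (apply pow_le; lra).
    apply Rplus_le_compat.
    + apply Rmult_le_compat; auto using Cmod_ge_0; [apply pow_le, Cmod_ge_0|].
      apply pow_incr; split; auto using Cmod_ge_0.
    + apply Rle_trans with (al * al ^ S m).
      * apply Rmult_le_compat; auto using Cmod_ge_0, g_le.
      * assert (0 <= al * al ^ S m) by (apply Rmult_le_pos; lra). nra.
Qed.

(** One majorant serves the whole disc [|z| <= r]; its quadratic factor leaves room for the double
    sum in [R_fun]. *)
Lemma ex_series_quadratic_bound (a : nat -> C) K z : Cmod z <= r ->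
  (forall k, Cmod (a k) <= K * (INR k + 1) ^ 2 * al ^ S k) ->
  ex_series (fun k => K * (INR k + 1) ^ 2 * (al * r) ^ S k) /\
  (forall k, Cmod (a k * z ^ S k) <= K * (INR k + 1) ^ 2 * (al * r) ^ S k).
Proof.
  intros Hz Ha. pose proof alpha_ge1.
  assert (Hq : 0 <= al * r) by (apply Rmult_le_pos; lra). split.
  - apply (ex_series_ext (fun k => (K * (al * r)) * ((INR k + 1) ^ 2 * (al * r) ^ k))).
    { intros k. simpl. ring. }
    apply (ex_series_scal (K * (al * r)) (fun k => (INR k + 1) ^ 2 * (al * r) ^ k)).
    apply ex_series_square_geom; auto.
  - intros k. rewrite Cmod_mult, Cmod_Cpow, Rpow_mult_distr, <- Rmult_assoc.
    apply Rmult_le_compat; auto using Cmod_ge_0, pow_le.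
    apply pow_incr; split; auto using Cmod_ge_0.
Qed.

Definition S_const : R :=
  1 + Cmod (d - 2 * (1 - t)) + Cmod (t * (d * kap)).

Lemma S_coef_le k : Cmod (S_coef (S k)) <= S_const * (INR k + 1) ^ 2 * al ^ S k.
Proof.
  destruct (linear_le_quadratic k) as [Hk1 Hk2]. unfold S_coef, S_const.
  assert (Hp : 0 <= al ^ S k) by (apply pow_le; pose proof alpha_ge1; lra).
  pose proof (g_le (S k)) as H1. pose proof (back_sum_le k) as H2.
  pose proof (even_power_le k) as H3. cbv beta in H1.
  set (p := al ^ S k) in *. set (c1 := (d - 2 * (1 - t))%C).
  set (c2 := (t * (d * kap))%C). set (n := INR k + 1) in *.
  unfold Cminus at 1 2.
  eapply Rle_trans; [apply Cmod_triangle|].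
  eapply Rle_trans; [apply Rplus_le_compat_r, Cmod_triangle|].
  rewrite !Cmod_opp, !Cmod_mult.
  assert (Hn : n * p <= n ^ 2 * p) by (apply Rmult_le_compat_r; auto).
  assert (Hn' : p <= n * p) by nra.
  replace ((1 + Cmod c1 + Cmod c2) * n ^ 2 * p)
    with (n ^ 2 * p + Cmod c1 * (n ^ 2 * p) + Cmod c2 * (n ^ 2 * p)) by ring.
  repeat apply Rplus_le_compat; try lra.
  - apply Rmult_le_compat_l; [apply Cmod_ge_0|]. lra.
  - fold c2. apply Rmult_le_compat_l; [apply Cmod_ge_0|]. lra.
Qed.

(** Both sides are multiplied by [1 - w]. The auxiliary series satisfy
    [tau (1 - w) = (1-t) z^2 (gam - kap)] and [eps (1 - w) = (1-t) z^2], so all becomes linear in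
    [gam] and [kap]. The coefficient of [gam] is then the one in [psi_series], and the [kap] terms
    in excess add up to [(d - 2) w kap]. *)
Lemma S_series z (psi : C) : Cmod z <= r -> psi_term X t x0 x z ~~> psi ->
  exists s : C, (fun k => S_coef (S k) * z ^ S k)%C ~~> s /\
    (s = z * psi + (d - 2) * kap * (w z / (1 - w z)))%C.
Proof.
  intros Hz Hpsi.
  destruct (psi_series X t x0 x r Xconn ht HM Hr Har z Hz) as (gam & psi' & Hgam & Hpsi' & E).
  rewrite (is_series_inj (V := C_NormedModule) _ _ _ Hpsi' Hpsi) in E. clear psi' Hpsi'.
  assert (Hw := one_minus_w_neq0 X t r ht HM Har z Hz).
  assert (Hg : (fun k => g (S k) * z ^ S k)%C ~~> (gam - kap)%C).
  { apply (@is_series_incr_1 C_AbsRing C_NormedModule (fun m => g m * z ^ m)%C).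
    change ((fun m => g m * z ^ m)%C ~~> (gam - kap + g 0%nat * z ^ 0)%C).
    cbv beta. rewrite C_op_0. change (entry one x0 x) with kap. simpl (z ^ 0)%C.
    replace (gam - kap + kap * 1)%C with gam by ring. auto. }
  pose proof alpha_ge1 as Hal.
  destruct (ex_series_quadratic_bound (fun k => back_sum (S k)) 1 z Hz) as [Hs1 Hs2].
  { intros k. eapply Rle_trans; [apply back_sum_le|].
    apply Rmult_le_compat_r; [apply pow_le; lra|].
    rewrite Rmult_1_l. apply linear_le_quadratic. }
  destruct (ex_series_C_le _ _ Hs2 Hs1) as [tau Htau].
  destruct (ex_series_quadratic_bound (fun k => even_power (S k)) 1 z Hz) as [He1 He2].
  { intros k. eapply Rle_trans; [apply even_power_le|].
    rewrite <- (Rmult_1_l (al ^ S k)) at 1.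
    apply Rmult_le_compat_r; [apply pow_le; lra|]. destruct (linear_le_quadratic k). lra. }
  destruct (ex_series_C_le _ _ He2 He1) as [eps Heps].
  exists ((gam - kap) + - (d - 2 * (1 - t)) * tau + - (t * (d * kap)) * eps)%C. split.
  - eapply is_series_C_ext; [|apply (is_series_C_plus _ _ _ _ (is_series_C_plus _ _ _ _ Hg
      (is_series_C_scal (- (d - 2 * (1 - t))) _ _ Htau))
      (is_series_C_scal (- (t * (d * kap))) _ _ Heps))].
    intros k. unfold S_coef. simpl. ring.
  - assert (Et := two_step_series (fun k => back_sum (S k)) (fun k => g (S k)) (1 - t) 0
      z tau (gam - kap)).
    assert (Ee := two_step_series (fun k => even_power (S k)) (fun k => RtoC 0) (1 - t)
      (1 - t) z eps 0).
    assert (Hz0 : (fun k => RtoC 0 * z ^ S k)%C ~~> RtoC 0).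
    { eapply is_series_C_ext; [|apply (is_series_C_first 0)]. intros [|k]; simpl; ring. }
    assert (Et' : (tau = 0 * z ^ 2 + ((1 - t) ^ 2 * z ^ 2 * tau
      + (1 - t) * z ^ 2 * (gam - kap)))%C).
    { apply Et; [reflexivity|reflexivity|exact back_sum_SSS|auto|auto]. }
    assert (Ee' : (eps = (1 - t) * z ^ 2 + ((1 - t) ^ 2 * z ^ 2 * eps
      + (1 - t) * z ^ 2 * 0))%C).
    { apply Ee; [reflexivity|unfold even_power; simpl; ring| |auto|auto].
      intros k. rewrite even_power_SSS. ring. }
    clear Et Ee.
    assert (Halg : forall a b c y : C, c <> 0%C -> (a * c = b * c + y)%C ->
      a = (b + y / c)%C).
    { intros a b c y Hc Ea. replace a with (a * c / c)%C by (field; auto).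
      rewrite Ea. field; auto. }
    replace (z * psi + (d - 2) * kap * (w z / (1 - w z)))%C
      with (z * psi + (d - 2) * kap * w z / (1 - w z))%C by (unfold Cdiv; ring).
    apply Halg; auto. rewrite E.
    assert (Et2 : (tau * (1 - w z) = (1 - t) * z ^ 2 * (gam - kap))%C).
    { transitivity (tau - w z * tau)%C; [ring|]. rewrite Et' at 1. ring. }
    assert (Ee2 : (eps * (1 - w z) = (1 - t) * z ^ 2)%C).
    { transitivity (eps - w z * eps)%C; [ring|]. rewrite Ee' at 1. ring. }
    transitivity ((gam - kap) * (1 - w z) + - (d - 2 * (1 - t)) * (tau * (1 - w z))
      + - (t * (d * kap)) * (eps * (1 - w z)))%C; [ring|].
    rewrite Et2, Ee2. ring.
Qed.

Lemma Cmod_1_minus_square : Cmod (1 - t ^ 2) <= al ^ 2.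
Proof.
  apply Rle_trans with (1 + Cmod t ^ 2).
  - eapply Rle_trans; [apply Cmod_triangle|].
    rewrite Cmod_opp, Cmod_1, Cmod_Cpow. lra.
  - pose proof (alpha_ge X t ht HM). pose proof (Cmod_ge_0 t). nra.
Qed.

Lemma Delta_c_le k : Cmod (Delta_c t k x) <= 2 * INR (maxdeg X) * al ^ k.
Proof.
  assert (Hd := deg_le X x).
  assert (Hc : forall y, Cmod (entry (C_op X t k) y y) <= al ^ k).
  { intros y. eapply Rle_trans; [apply entry_le|]. apply C_op_norm; auto. }
  unfold Delta_c, Cminus. eapply Rle_trans; [apply Cmod_triangle|].
  rewrite Cmod_mult, Cmod_opp, Cmod_R, Rabs_pos_eq by apply pos_INR.
  replace (2 * INR (maxdeg X) * al ^ k)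
    with (INR (maxdeg X) * al ^ k + INR (maxdeg X) * al ^ k) by ring.
  assert (0 <= al ^ k) by (apply pow_le; pose proof alpha_ge1; lra).
  apply Rplus_le_compat.
  - apply Rmult_le_compat; auto using pos_INR, Cmod_ge_0.
  - eapply Rle_trans; [apply csum_Cmod|].
    eapply Rle_trans; [apply rsum_le; intros e _; apply (Hc (ter e))|].
    rewrite rsum_const. apply Rmult_le_compat_r; auto.
Qed.

(** There are at most [jmax^2] summands. With [|1-t| <= alpha] and [|1-t^2| <= alpha^2] the
    exponents of [alpha] in each add up to less than [S k]. *)
Lemma R_fun_le k : Cmod (R_fun t (S k) x) <= 2 * INR (maxdeg X) * (INR k + 1) ^ 2 * al ^ S k.
Proof.
  pose proof alpha_ge1 as Hal. pose proof (jmax_le k) as Hj.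
  pose proof (pos_INR (maxdeg X)) as HM0.
  assert (Hb0 : 0 <= 2 * INR (maxdeg X) * al ^ S k)
    by (apply Rmult_le_pos; [lra|apply pow_le; lra]).
  assert (Hjm : INR (jmax (S k)) <= INR k + 1) by (rewrite <- S_INR; apply le_INR; lia).
  apply Rle_trans with (INR (jmax (S k)) * (INR (jmax (S k)) *
    (2 * INR (maxdeg X) * al ^ S k))).
  - apply sum_n_m_C_le; [apply Rmult_le_pos; auto using pos_INR|lia|]. intros j Hj'.
    apply Rle_trans with (INR j * (2 * INR (maxdeg X) * al ^ S k)).
    + apply sum_n_m_C_le; [auto|lia|]. intros i Hi.
      rewrite !Cmod_mult, !Cmod_Cpow.
      apply Rle_trans with (al ^ (2 * (j - i)) * (al ^ 2) ^ (i - 1)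
        * (2 * INR (maxdeg X) * al ^ (S k - 2 * j))).
      * apply Rmult_le_compat; auto using Cmod_ge_0, Delta_c_le.
        { apply Rmult_le_pos; apply pow_le, Cmod_ge_0. }
        apply Rmult_le_compat; try (apply pow_le, Cmod_ge_0);
          apply pow_incr; split; auto using Cmod_ge_0, Cmod_1_minus_le, Cmod_1_minus_square.
      * rewrite <- pow_mult.
        replace (al ^ (2 * (j - i)) * al ^ (2 * (i - 1))
          * (2 * INR (maxdeg X) * al ^ (S k - 2 * j)))
          with (2 * INR (maxdeg X) * (al ^ (2 * (j - i)) * al ^ (2 * (i - 1))
          * al ^ (S k - 2 * j))) by ring.
        rewrite <- !pow_add. apply Rmult_le_compat_l; [lra|]. apply Rle_pow; auto. lia.
    + apply Rmult_le_compat_r; auto. apply le_INR; lia.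
  - replace (2 * INR (maxdeg X) * (INR k + 1) ^ 2 * al ^ S k)
      with ((INR k + 1) * ((INR k + 1) * (2 * INR (maxdeg X) * al ^ S k))) by ring.
    apply Rmult_le_compat; auto using pos_INR.
    + apply Rmult_le_pos; auto using pos_INR.
    + apply Rmult_le_compat_r; auto.
Qed.

End Coefficients.

(** * Integration along the segment *)

Lemma Cmod_inv_INR k : Cmod (/ RtoC (INR (S k))) <= 1.
Proof.
  assert (1 <= INR (S k)) by (apply (le_INR 1); lia).
  rewrite <- RtoC_inv, Cmod_R, Rabs_pos_eq.
  - rewrite <- Rinv_1. apply Rinv_le_contravar; lra.
  - left; apply Rinv_0_lt_compat; lra.
  - lra.
Qed.

Section Segment.
Variables (X : bounded_graph) (t : C) (x0 x : VX X) (u : C).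
Notation V := (VX X).
Notation Op := (bop (l2_NormedModule V)).
Notation r := (Cmod u).
Hypothesis Xconn : connected_graph X.
Hypothesis ht : Cmod t < 1.
Hypothesis HM : (1 <= maxdeg X)%nat.
Hypothesis Har : alpha X t * r < 1.

Notation f := (quad V (A_X X) (Q_X X t) (1 - t)).
Notation csum_op := (comm_sum V (A_X X) (Q_X X t) (1 - t)).
Notation al := (alpha X t).
Notation phi := (f_bound X t r).
Notation v := (delta x0).
Notation kap := (kronecker x0 x).
Notation d := (RtoC (INR (deg x))).
Notation w := ((1 - t) ^ 2 * u ^ 2)%C.

Let Hr : 0 <= r := Cmod_ge_0 u.
Let Hphi0 : 0 <= phi := f_bound_ge0 X t HM r Hr.
Let Hphi1 : phi < 1 := f_bound_lt1 X t HM r Hr Har.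

(** [D_X] and [Q_X t] differ by a scalar, so they have the same commutator with [A_X]; the index
    [n = k + 2] of the statement corresponds to [comm_sum] at [n - 1]. *)
Lemma comm_term_eq z k :
  comm_term t x0 x z k = (/ RtoC (INR (S (S k))) * csum_op (S k) z v x)%C.
Proof.
  unfold comm_term. replace (k + 2)%nat with (S (S k)) by lia. f_equal.
  replace (S (S k) - 1)%nat with (S k) by lia.
  unfold comm_sum. rewrite sum_n_m_apply. apply sum_n_m_ext. intros j.
  rewrite bop_scalE, l2_scalE. f_equal.
  assert (E : (A_X X * D_X X - D_X X * A_X X)%op
    = (A_X X * Q_X X t - Q_X X t * A_X X)%op)
    by (unfold Q_X; change (I_X X) with (one : Op); op_ring).
  rewrite E. reflexivity.
Qed.

(** Along the recursion of [comm_sum] the weights add up by [(n+1)^2 + (n+2) <= (n+2)^2]. *)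
Lemma comm_sum_le z n : Cmod z <= r ->
  bop_norm (csum_op (S n) z)
    <= bop_norm (A_X X * Q_X X t - Q_X X t * A_X X)%op * ((INR n + 1) ^ 2 * phi ^ n).
Proof.
  intros Hz. assert (Hf := f_norm X t r Xconn ht HM z Hz).
  set (K := bop_norm (A_X X * Q_X X t - Q_X X t * A_X X)%op).
  assert (HK : 0 <= K) by apply bop_norm_ge0.
  assert (Hc : forall n, bop_norm ((RtoC (INR (S n))) *:
    ((A_X X * Q_X X t - Q_X X t * A_X X) * f z ^ n))%op <= (INR n + 1) * (K * phi ^ n)).
  { intros m. eapply Rle_trans; [apply bop_norm_scal|].
    rewrite Cmod_R, Rabs_pos_eq, S_INR by apply pos_INR.
    apply Rmult_le_compat_l; [pose proof (pos_INR m); lra|].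
    eapply Rle_trans; [apply bop_norm_mult|].
    apply Rmult_le_compat_l; auto. apply bop_norm_pow; auto. }
  induction n as [|n IH].
  - rewrite comm_sum_S. eapply Rle_trans; [apply bop_norm_triangle|].
    replace (K * ((INR 0 + 1) ^ 2 * phi ^ 0)) with (phi * 0 + (INR 0 + 1) * (K * phi ^ 0))
      by (simpl; ring).
    apply Rplus_le_compat; auto. eapply Rle_trans; [apply bop_norm_mult|].
    apply Rmult_le_compat; auto using bop_norm_ge0.
    unfold comm_sum. rewrite sum_n_m_zero by lia. right; apply bop_norm_zero.
  - rewrite comm_sum_S. eapply Rle_trans; [apply bop_norm_triangle|].
    apply Rle_trans with (phi * (K * ((INR n + 1) ^ 2 * phi ^ n))
      + (INR (S n) + 1) * (K * phi ^ S n)).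
    + apply Rplus_le_compat; [|apply Hc]. eapply Rle_trans; [apply bop_norm_mult|].
      apply Rmult_le_compat; auto using bop_norm_ge0.
    + rewrite S_INR. simpl pow. pose proof (pos_INR n).
      assert (HP : 0 <= K * (phi * phi ^ n))
        by (apply Rmult_le_pos; auto; apply Rmult_le_pos; auto using pow_le).
      set (P := K * (phi * phi ^ n)) in *.
      replace (phi * (K * ((INR n + 1) * ((INR n + 1) * 1) * phi ^ n)))
        with ((INR n + 1) ^ 2 * P) by (unfold P; ring).
      replace (K * ((INR n + 1 + 1) * ((INR n + 1 + 1) * 1) * (phi * phi ^ n)))
        with ((INR n + 1 + 1) ^ 2 * P) by (unfold P; ring).
      assert (0 <= INR n * P) by (apply Rmult_le_pos; auto). nra.
Qed.

Definition comm_const : R := bop_norm (A_X X * Q_X X t - Q_X X t * A_X X)%op.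

Lemma comm_term_le z k : Cmod z <= r ->
  Cmod (comm_term t x0 x z k) <= comm_const * ((INR k + 1) ^ 2 * phi ^ k).
Proof.
  intros Hz. rewrite comm_term_eq, Cmod_mult.
  rewrite <- (Rmult_1_l (comm_const * _)).
  apply Rmult_le_compat; auto using Cmod_ge_0, Cmod_inv_INR.
  eapply Rle_trans; [apply entry_le|]. apply comm_sum_le; auto.
Qed.

Lemma ex_series_comm_bound : ex_series (fun k => comm_const * ((INR k + 1) ^ 2 * phi ^ k)).
Proof.
  apply (ex_series_scal comm_const (fun k => (INR k + 1) ^ 2 * phi ^ k)).
  apply ex_series_square_geom; auto.
Qed.

Lemma comm_series z : Cmod z <= r -> exists l : C, comm_term t x0 x z ~~> l.
Proof.
  intros Hz. apply (ex_series_C_le _ _ (fun k => comm_term_le z k Hz)).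
  apply ex_series_comm_bound.
Qed.

Lemma segment_le s : 0 <= s <= 1 -> Cmod (RtoC s * u) <= r.
Proof.
  intros Hs. rewrite Cmod_mult, Cmod_R, Rabs_pos_eq by lra.
  pose proof (Cmod_ge_0 u). nra.
Qed.

Definition psi (z : C) : C := series_sum (V := C_NormedModule) (psi_term X t x0 x z).

Lemma psi_correct z : Cmod z <= r -> psi_term X t x0 x z ~~> psi z.
Proof.
  intros Hz.
  destruct (psi_series X t x0 x r Xconn ht HM Hr Har z Hz) as (gam & l & _ & Hl & _).
  unfold psi. rewrite (series_sum_unique (V := C_NormedModule) _ _ Hl). auto.
Qed.

(** The derivative along the segment of [f(z)^n / n], [n = k + 1]. *)
Definition log_deriv_term (k : nat) (s : R) : C :=
  (/ RtoC (INR (S k)) * (dpow V (A_X X) (Q_X X t) (1 - t) (S k) (RtoC s * u) v x * u))%C.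

(** The first power has no commutator, so the commutator series lags one index behind; hence the
    [match]. *)
Lemma log_deriv_term_eq k s :
  log_deriv_term k s =
    (u * psi_term X t x0 x (RtoC s * u) k
     + - ((1 - t) * (RtoC s * u) ^ 2 * u) *
         match k with O => RtoC 0 | S k => comm_term t x0 x (RtoC s * u)%C k end)%C.
Proof.
  assert (Hk : RtoC (INR (S k)) <> 0%C).
  { intros E. apply RtoC_inj in E. revert E. apply not_0_INR. lia. }
  unfold log_deriv_term, psi_term. rewrite dpow_S. op_expand. op_values.
  assert (E : match k with O => RtoC 0 | S k => comm_term t x0 x (RtoC s * u)%C k end
    = (/ RtoC (INR (S k)) * csum_op k (RtoC s * u)%C v x)%C).
  { destruct k as [|k]; [|apply comm_term_eq].
    unfold comm_sum. rewrite sum_n_m_zero by lia. rewrite bop_zeroE, l2_zeroE. ring. }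
  rewrite E. clear E. generalize dependent (RtoC (INR (S k))). intros n Hn.
  field. auto.
Qed.

(** The lower limit contributes nothing because [f 0] is the zero operator. *)
Lemma log_deriv_is_RInt k :
  C_is_RInt (log_deriv_term k) 0 1 (entry (op_log_term (f u) k) x0 x).
Proof.
  assert (H := op_poly_is_RInt V _ _ u v x (op_poly_pow V (A_X X) (Q_X X t) (1 - t) (S k))).
  assert (E : entry (op_log_term (f u) k) x0 x =
    (/ RtoC (INR (S k)) * ((f u ^ S k)%op v x - (f 0 ^ S k)%op v x))%C).
  { unfold op_log_term, entry. replace (k + 1)%nat with (S k) by lia.
    rewrite bop_scalE, l2_scalE. f_equal.
    assert (E0 : (f 0 ^ S k)%op v x = 0%C).
    { simpl pow_n. unfold quad. repeat (progress op_expand). op_values. ring. }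
    rewrite E0. ring. }
  rewrite E. exact (is_RInt_C_scal (/ RtoC (INR (S k))) _ _ _ _ H).
Qed.

Lemma log_deriv_series s : 0 <= s <= 1 ->
  (fun k => log_deriv_term k s) ~~>
    (u * psi (RtoC s * u) - integrand t x0 x (RtoC s * u) * u)%C.
Proof.
  intros Hs. assert (Hz := segment_le s Hs).
  destruct (comm_series _ Hz) as [l Hl].
  eapply is_series_C_ext; [intros k; symmetry; apply log_deriv_term_eq|].
  assert (E : (u * psi (RtoC s * u) - integrand t x0 x (RtoC s * u) * u
    = u * psi (RtoC s * u) + - ((1 - t) * (RtoC s * u) ^ 2 * u) * l)%C).
  { unfold integrand. rewrite (series_sum_unique (V := C_NormedModule) _ _ Hl). ring. }
  rewrite E. apply is_series_C_plus; apply is_series_C_scal.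
  - apply psi_correct; auto.
  - apply is_series_C_shift; auto.
Qed.

Lemma log_series : exists L : C,
  (fun k => entry (op_log_term (f u) k) x0 x) ~~> L /\
  C_is_RInt (fun s => (u * psi (RtoC s * u) - integrand t x0 x (RtoC s * u) * u)%C) 0 1 L.
Proof.
  set (K := INR (maxdeg X) + 2 * r * (2 * INR (maxdeg X))).
  pose (b := fun k => r * (K * phi ^ k) + Cmod (1 - t) * r ^ 2 * r *
    match k with O => 0 | S k => comm_const * ((INR k + 1) ^ 2 * phi ^ k) end).
  apply (is_RInt_series log_deriv_term _ _ b).
  - apply log_deriv_is_RInt.
  - intros k s Hs. assert (Hz : Cmod (RtoC s * u) <= r) by (apply segment_le; lra).
    rewrite log_deriv_term_eq. unfold b. eapply Rle_trans; [apply Cmod_triangle|].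
    rewrite !Cmod_mult, Cmod_opp, !Cmod_mult, Cmod_Cpow.
    apply Rplus_le_compat.
    + apply Rmult_le_compat_l; auto. apply psi_term_le; auto.
    + apply Rmult_le_compat; auto using Cmod_ge_0.
      * repeat apply Rmult_le_pos; auto using Cmod_ge_0, Rle_0_1.
      * apply Rmult_le_compat_r; auto. apply Rmult_le_compat_l; [apply Cmod_ge_0|].
        apply pow_incr; split; auto using Cmod_ge_0.
      * destruct k; [rewrite Cmod_0; lra|]. apply comm_term_le; auto.
  - apply (ex_series_plus (V := R_NormedModule)).
    + apply (ex_series_ext (fun k => (r * K) * phi ^ k)); [intros; simpl; ring|].
      apply (ex_series_scal (r * K) (fun k => phi ^ k)). apply Series.ex_series_geom.
      rewrite Rabs_pos_eq; auto.
    + apply (ex_series_scal (V := R_NormedModule)).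
      apply ex_series_incr_1. apply ex_series_comm_bound.
  - intros s Hs. apply log_deriv_series; lra.
Qed.

(** The terms are [S_(k+1) z^(k+1) / s] at [z = s u], that is [S_(k+1) u^(k+1) s^k], and integrating
    [s^k] produces the [1 / (k+1)] in the exponent of [Z_X]. Their sum is obtained by dividing
    [S_series] by [s], which is possible for [s > 0]. *)
Lemma S_series_integral : exists L : C,
  (fun k => S_coef X t x0 x (S k) / RtoC (INR (S k)) * u ^ S k)%C ~~> L /\
  C_is_RInt (fun s => (u * psi (RtoC s * u)
    + (d - 2) * kap * (w * RtoC s / (1 - w * RtoC s ^ 2)))%C) 0 1 L.
Proof.
  assert (Hu : r <= r) by lra.
  destruct (ex_series_quadratic_bound X t r ht HM Hr Har
    (fun k => S_coef X t x0 x (S k)) (S_const X t x0 x) u Hu) as [Hb1 Hb2].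
  { intros k. apply S_coef_le; auto. }
  eapply (is_RInt_series
    (fun k s => S_coef X t x0 x (S k) * u ^ S k * RtoC (s ^ k))%C _ _ _ _ _ Hb1).
  intros s Hs. assert (Hz : Cmod (RtoC s * u) <= r) by (apply segment_le; lra).
  assert (Hs0 : RtoC s <> 0%C) by (intros E; apply RtoC_inj in E; lra).
  destruct (S_series X t x0 x r Xconn ht HM Hr Har _ _ Hz (psi_correct _ Hz))
    as (l & Hl & El).
  assert (H := is_series_C_scal (/ RtoC s) _ _ Hl).
  assert (E : (/ RtoC s * l = u * psi (RtoC s * u)
    + (d - 2) * kap * (w * RtoC s / (1 - w * RtoC s ^ 2)))%C).
  { rewrite El. replace (1 - w * RtoC s ^ 2)%C with (1 - (1 - t) ^ 2 * (RtoC s * u) ^ 2)%C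
      by ring. unfold Cdiv. generalize (/ (1 - (1 - t) ^ 2 * (RtoC s * u) ^ 2))%C.
    intros c. field. auto. }
  rewrite <- E. eapply is_series_C_ext; [|apply H]. intros k. cbv beta.
  rewrite RtoC_pow, Cpow_mult_l, (Cpow_S (RtoC s)). field. auto.
  Unshelve.
  - intros k. cbv beta.
    replace (S_coef X t x0 x (S k) / RtoC (INR (S k)) * u ^ S k)%C
      with (S_coef X t x0 x (S k) * u ^ S k * RtoC (/ INR (S k)))%C.
    2: { rewrite RtoC_inv by (apply not_0_INR; lia). unfold Cdiv. ring. }
    apply is_RInt_C_scal, is_RInt_RtoC.
    assert (HS : INR (S k) <> 0) by (apply not_0_INR; lia).
    replace (/ INR (S k)) with (minus (1 ^ S k / INR (S k)) (0 ^ S k / INR (S k))).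
    2: { rewrite pow1, pow_i by lia. unfold minus, plus, opp; simpl AbelianGroup.sort.
         change (1 / INR (S k) + - (0 / INR (S k)) = / INR (S k)). field; auto. }
    apply (is_RInt_derive (V := R_CompleteNormedModule) (fun s => s ^ S k / INR (S k))).
    + intros s _.
      replace (s ^ k) with (INR (S k) * 1 * s ^ Init.Nat.pred (S k) * / INR (S k))
        by (simpl Init.Nat.pred; field; auto).
      apply (is_derive_scal_l (V := R_NormedModule) (fun s => s ^ S k)).
      apply (is_derive_pow (fun s => s) (S k) s 1 (is_derive_id s)).
    + intros s _. apply (@ex_derive_continuous R_AbsRing R_NormedModule).
      auto_derive; auto.
  - intros k s Hs. cbv beta. rewrite Cmod_mult, Cmod_R.
    rewrite <- (Rmult_1_r (S_const X t x0 x * (INR k + 1) ^ 2 * (al * r) ^ S k)).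
    apply Rmult_le_compat; auto using Cmod_ge_0, Rabs_pos.
    rewrite Rabs_pos_eq by (apply pow_le; lra).
    rewrite <- (pow1 k). apply pow_incr; lra.
Qed.

End Segment.


(** Besides the identity, the conclusion records that the series, the logarithm
    and the integral occurring in it exist. *)
Theorem theorem4p5 (X : bounded_graph)
  (X_connected : connected_graph X) (X_countable : countable_graph X)
  (X_simple : simple_graph X)
  (t u : C) (ht : Cmod t < 1) (hu : Cmod u < 1 / alpha X t) (x0 x : VX X) :
  ex_series (V := C_NormedModule) (Z_term u t x0 x) /\
  op_log_defined
    (I_X X - u *: (D_X X - Delta_X X) + ((1 - t) * u ^ 2) *: Q_X X t)%op /\
  (forall s : R, 0 <= s <= 1 ->
     ex_series (V := C_NormedModule) (comm_term t x0 x (RtoC s * u)%C)) /\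
  ex_segment_int (integrand t x0 x) u /\
  ex_series (V := C_NormedModule) (R_term u t x0 x) /\
  Z_X X u t x0 x =
    (Cpower (1 - (1 - t) ^ 2 * u ^ 2)
       (- ((RtoC (INR (deg x0)) - 2) / 2 * kronecker x0 x))
     * Cexp (- entry (op_log
         (I_X X - u *: (D_X X - Delta_X X) + ((1 - t) * u ^ 2) *: Q_X X t)%op)
         x0 x)
     * Cexp (segment_int (integrand t x0 x) u)
     * Cexp (entry (t *: D_X X - C_op X t 2)%op x0 x / 2 * (1 - t) * u ^ 2)
     * Cexp (series_sum (V := C_NormedModule) (R_term u t x0 x)))%C.
Proof.
  (* If the maximal degree is 0, then [alpha] is 0, and since [/ 0 = 0] the hypothesis [hu] would
     read [Cmod u < 0]. *)
  destruct (Nat.eq_0_gt_0_cases (maxdeg X)) as [H0|HM].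
  { exfalso. assert (Ha : alpha X t = 0).
    { unfold alpha. rewrite H0. simpl INR.
      replace (0 ^ 2 + 4 * (Cmod t + 1) * 0) with 0 by ring. rewrite sqrt_0. lra. }
    rewrite Ha in hu. unfold Rdiv in hu. rewrite Rinv_0, Rmult_0_r in hu.
    pose proof (Cmod_ge_0 u); lra. }
  assert (Ha0 := alpha_gt0 X t HM).
  assert (Har : alpha X t * Cmod u < 1).
  { apply (Rmult_lt_compat_l (alpha X t)) in hu; auto.
    replace (alpha X t * (1 / alpha X t)) with 1 in hu by (field; lra). auto. }
  assert (Hr := Cmod_ge_0 u). assert (Hu : Cmod u <= Cmod u) by lra.
  set (T := (I_X X - u *: (D_X X - Delta_X X) + ((1 - t) * u ^ 2) *: Q_X X t)%op).
  set (f := quad (VX X) (A_X X) (Q_X X t) (1 - t) u).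
  assert (ET : (one - T)%op = f).
  { unfold T, f, quad, Delta_X. change (I_X X) with (one : bop (l2_NormedModule (VX X))).
    op_ring. }
  assert (Hf : bop_norm f <= f_bound X t (Cmod u)) by (apply f_norm; auto).
  assert (Hphi0 := f_bound_ge0 X t HM (Cmod u) Hr).
  assert (Hphi1 := f_bound_lt1 X t HM (Cmod u) Hr Har).
  assert (Hlog : ex_series (V := bop_NormedModule (l2_NormedModule (VX X))) (op_log_term f)).
  { destruct (Series.ex_series_geom (f_bound X t (Cmod u))) as [B HB].
    { rewrite Rabs_pos_eq; auto. }
    apply (ex_series_op _ _ (fun k => f_bound X t (Cmod u) ^ k) B); [|exact HB].
    intros k. unfold op_log_term. replace (k + 1)%nat with (S k) by lia.
    eapply Rle_trans; [apply bop_norm_scal|].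
    rewrite <- (Rmult_1_l (f_bound X t (Cmod u) ^ k)).
    apply Rmult_le_compat;
      [apply Cmod_ge_0|apply bop_norm_ge0|apply Cmod_inv_INR|].
    eapply Rle_trans; [apply bop_norm_pow; apply Hf|].
    simpl. rewrite <- (Rmult_1_l (f_bound X t (Cmod u) ^ k)) at 2.
    apply Rmult_le_compat_r; [apply pow_le|]; lra. }
  assert (HTlog : op_log_defined T).
  { unfold op_log_defined. rewrite ET. split; auto.
    eapply Rle_lt_trans; [apply Hf|auto]. }
  destruct (log_series X t x0 x u X_connected ht HM Har) as (L & HL & HLint).
  destruct (S_series_integral X t x0 x u X_connected ht HM Har) as (s1 & HS & HSint).
  assert (EL : entry (op_log T) x0 x = (- L)%C).
  { destruct Hlog as [Lop HLop]. unfold op_log. rewrite ET, (series_sum_unique _ _ HLop).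
    unfold entry. rewrite bop_oppE, l2_oppE. f_equal.
    apply (is_series_inj (V := C_NormedModule) _ _ _ (is_series_apply _ _ _ _ x HLop)).
    exact HL. }
  set (kap := kronecker x0 x) in *. set (d := RtoC (INR (deg x))) in *.
  set (w := ((1 - t) ^ 2 * u ^ 2)%C) in *.
  assert (Hw : Cmod w < 1) by (apply (one_minus_radius X t ht HM (Cmod u)); auto).
  (* The commutator integral is found by difference: in this combination the [psi] terms and the
     terms with denominator [1 - w s^2] cancel. Its value is the claimed identity in logarithmic
     form. *)
  assert (Hint : is_RInt (V := C_R_NormedModule) (segment_param (integrand t x0 x) u) 0 1
    (s1 + ((d - 2) * kap / 2 * Clog (1 - w) + (-1) * L))%C).
  { eapply is_RInt_ext; [|apply (is_RInt_C_plus _ _ _ _ _ _ HSint (is_RInt_C_plus _ _ _ _ _ _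
      (is_RInt_C_scal ((d - 2) * kap / 2) _ _ _ _ (Clog_integral w Hw))
      (is_RInt_C_scal (-1) _ _ _ _ HLint)))].
    intros s _. cbv beta. unfold segment_param, Cdiv.
    generalize (/ (1 - w * RtoC s ^ 2))%C. intros c.
    match goal with |- ?a = ?b => change (@eq C a b) end. field. }
  destruct (ex_series_quadratic_bound X t (Cmod u) ht HM Hr Har
    (fun k => (1 - t) * entry (R_op X t (S k)) x0 x)%C
    (Cmod (1 - t) * (2 * INR (maxdeg X)) * Cmod kap) u Hu) as [HR1 HR2].
  { intros k. rewrite entry_R_op, !Cmod_mult. fold kap.
    replace (Cmod (1 - t) * (2 * INR (maxdeg X)) * Cmod kap * (INR k + 1) ^ 2
      * alpha X t ^ S k) with (Cmod (1 - t) * ((2 * INR (maxdeg X)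
      * (INR k + 1) ^ 2 * alpha X t ^ S k) * Cmod kap)) by ring.
    apply Rmult_le_compat_l; [apply Cmod_ge_0|].
    apply Rmult_le_compat_r; [apply Cmod_ge_0|]. apply R_fun_le; auto. }
  assert (HR : exists rho : C, R_term u t x0 x ~~> rho).
  { apply (ex_series_C_le _ (fun k => Cmod (1 - t) * (2 * INR (maxdeg X)) * Cmod kap
      * (INR (k + 2) + 1) ^ 2 * (alpha X t * Cmod u) ^ S (k + 2))).
    - intros k. eapply Rle_trans; [|apply (HR2 (k + 2)%nat)].
      unfold R_term. replace (k + 3)%nat with (S (k + 2)) by lia.
      unfold Cdiv. rewrite !Cmod_mult.
      apply Rmult_le_compat_r; [apply Cmod_ge_0|].
      eapply Rle_trans; [apply Rmult_le_compat_l; [|apply Cmod_inv_INR]|].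
      + apply Rmult_le_pos; apply Cmod_ge_0.
      + rewrite Rmult_1_r. apply Rle_refl.
    - apply (ex_series_ext (fun k => (fun k => Cmod (1 - t) * (2 * INR (maxdeg X)) * Cmod kap
        * (INR k + 1) ^ 2 * (alpha X t * Cmod u) ^ S k) (2 + k)%nat)).
      + intros k. rewrite (Nat.add_comm k 2). auto.
      + refine (proj1 (ex_series_incr_n (V := R_NormedModule) _ 2) HR1). }
  destruct HR as [rho Hrho].
  set (q := (entry (t *: D_X X - C_op X t 2)%op x0 x / 2 * (1 - t) * u ^ 2)%C).
  (* The corrections start at [m = 2] for [q] and at [m = 3] for [rho], hence one and two shifts. *)
  assert (HZ : Z_term u t x0 x ~~> (s1 + (q + rho))%C).
  { eapply is_series_C_ext; [|apply (is_series_C_plus _ _ _ _ HS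
      (is_series_C_plus _ _ _ _ (is_series_C_shift _ _ (is_series_C_first q))
        (is_series_C_shift _ _ (is_series_C_shift _ _ Hrho))))].
    intros k. cbv beta. unfold Z_term. replace (k + 1)%nat with (S k) by lia.
    destruct k as [|[|k]].
    - rewrite entry_Ccbc_1. unfold Cdiv. ring.
    - rewrite entry_Ccbc_2. unfold q, Cdiv. change (INR 2) with 2. ring.
    - rewrite entry_Ccbc_SSS. unfold R_term.
      replace (k + 3)%nat with (S (S (S k))) by lia.
      unfold Cdiv. ring. }
  split; [exists (s1 + (q + rho))%C; exact HZ|]. split; [auto|].
  split; [|split; [|split]].
  - intros s Hs. apply (comm_series X t x0 x u X_connected ht HM Har).
    apply segment_le; auto.
  - eexists. exact Hint.
  - exists rho. exact Hrho.
  - unfold Z_X. rewrite (series_sum_unique (V := C_NormedModule) _ _ HZ).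
    rewrite (series_sum_unique (V := C_NormedModule) _ _ Hrho).
    unfold segment_int. rewrite (is_RInt_unique (V := C_R_CompleteNormedModule) _ _ _ _ Hint).
    rewrite EL. unfold Cpower. rewrite <- !Cexp_plus. f_equal. fold w.
    (* The computation produced [deg x], the statement has [deg x0]; they agree where the Kronecker
       delta is nonzero. *)
    assert (Ed : (RtoC (INR (deg x0)) * kap = d * kap)%C).
    { unfold kap, kronecker, d. destruct (excluded_middle_informative (x0 = x)) as [->|_];
        ring. }
    assert (E2 : ((RtoC (INR (deg x0)) - 2) / 2 * kap = (d - 2) * kap / 2)%C).
    { transitivity ((RtoC (INR (deg x0)) * kap - 2 * kap) / 2)%C; [field|].
      rewrite Ed. field. }
    fold kap. rewrite E2. ring.
Qed.
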